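(* Let $\mathcal{A}=E\cup B\subset\mathbb{Z}^d$ with $E=\{\mathbf{a}_1,\ldots,\mathbf{a}_r\}$, $B=\{\mathbf{b}_1,\ldots,\mathbf{b}_s\}$, be such that no nontrivial $\mathbb{N}$-linear combination of the elements of $\mathcal{A}$ is zero and $\mathrm{pos}(\mathcal{A})=\mathrm{pos}(E)$. Let $S$ be the semigroup generated by $\mathcal{A}$, assume that $S$ is simplicial and that $E$ is chosen with $r=\mathrm{rank}(\mathbb{Z}\mathcal{A})$. Let $\prec$ be an $\mathcal{A}$-graded reverse lexicographical monomial order on $\Bbbk[\mathbf{Y},\mathbf{Z}]$ with $Y_i\prec Z_j$ for all $i,j$. Then $\Bbbk[S]$ is Cohen-Macaulay if and only if the minimal monomial generators of $\mathrm{in}_\prec(I_\mathcal{A})$ do not involve the variables $Y_1,\ldots,Y_r$.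
   Context: $\mathbb{N}$ denotes the nonnegative integers and $\Bbbk$ is a field. $\mathcal{A}=\{\mathbf{a}_1,\ldots,\mathbf{a}_n\}\subset\mathbb{Z}^d$ is a finite set such that $\sum u_i\mathbf{a}_i=0$ with $u_i\in\mathbb{N}$ implies all $u_i=0$. $S=\mathbb{N}\mathbf{a}_1+\cdots+\mathbb{N}\mathbf{a}_n$, and $\mathbb{Z}\mathcal{A}$ is the subgroup of $\mathbb{Z}^d$ generated by $\mathcal{A}$. The polyhedral cone is $\mathrm{pos}(\mathcal{A})=\{\sum\lambda_i\mathbf{a}_i\mid\lambda_i\in\mathbb{Q}_{\ge0}\}$. The elements are labelled so that $\mathrm{pos}(\mathcal{A})=\mathrm{pos}(E)$ with $E=\{\mathbf{a}_1,\ldots,\mathbf{a}_r\}$, and $\mathbf{b}_j=\mathbf{a}_{r+j}$, $j=1,\ldots,s=n-r$, $B=\{\mathbf{b}_1,\ldots,\mathbf{b}_s\}$. $S$ is simplicial if $\mathrm{pos}(\mathcal{A})$ can be generated by $\dim_\mathbb{Q}(\mathrm{pos}(\mathcal{A}))=\mathrm{rank}(\mathbb{Z}\mathcal{A})$ elements of $\mathcal{A}$. $\Bbbk[\mathbf{Y},\mathbf{Z}]=\Bbbk[Y_1,\ldots,Y_r,Z_1,\ldots,Z_s]$. For $(\mathbf{v},\mathbf{u})\in\mathbb{N}^r\times\mathbb{N}^s$, $\deg_\mathcal{A}(\mathbf{v},\mathbf{u})=\sum_i v_i\mathbf{a}_i+\sum_j u_j\mathbf{b}_j\in S$. $\Bbbk[S]=\bigoplus_{\mathbf{a}\in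 S}\Bbbk\chi^{\mathbf{a}}$ is the semigroup algebra, and $I_\mathcal{A}$ is the kernel of the $\Bbbk$-algebra map $\Bbbk[\mathbf{Y},\mathbf{Z}]\to\Bbbk[S]$, $\mathbf{Y}^{\mathbf{v}}\mathbf{Z}^{\mathbf{u}}\mapsto\chi^{\deg_\mathcal{A}(\mathbf{v},\mathbf{u})}$. $\mathcal{A}$-graded reverse lexicographical order $\prec$ with $Y_i\prec Z_j$: fix a total order on the variables in which every $Y_i$ is smaller than every $Z_j$. Then $\mathbf{Y}^{\mathbf{v}'}\mathbf{Z}^{\mathbf{u}'}\prec\mathbf{Y}^{\mathbf{v}}\mathbf{Z}^{\mathbf{u}}$ iff either the leftmost nonzero entry of $\deg_\mathcal{A}(\mathbf{v},\mathbf{u})-\deg_\mathcal{A}(\mathbf{v}',\mathbf{u}')\in\mathbb{Z}^d$ is positive, or the two degrees are equal and the smallest variable whose exponents in the two monomials differ has larger exponent in $\mathbf{Y}^{\mathbf{v}'}\mathbf{Z}^{\mathbf{u}'}$. $\mathrm{in}_\prec(I_\mathcal{A})$ is the ideal generated by the $\prec$-leading (largest) monomials of the nonzero elements of $I_\mathcal{A}$. *)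

(* Defs.v *)
From HB Require Import structures.
From mathcomp Require Import all_boot all_order all_algebra.
From mathcomp Require Import boolp.
(* The notations of monalg clash with those of mpoly. *)
From mathcomp Require Import -(notations) monalg.
From mathcomp Require Import mpoly.

Set Implicit Arguments.
Unset Strict Implicit.
Unset Printing Implicit Defensive.

Import Order.TTheory GRing.Theory Num.Theory.
Local Open Scope ring_scope.

Section CohenMacaulay.
Variable R : comNzRingType.
Implicit Types (X : R -> Prop) (xs : seq R) (I P : {pred R}).

Definition ideal_generated X (f : R) : Prop :=
  exists2 c : seq (R * R),
    forall p, p \in c -> X p.2 & f = \sum_(p <- c) p.1 * p.2.

(* [idealr_closed] means proper ideal; the unit ideal is always finitely
   generated, so nothing is lost. *)
Definition noetherian : Prop :=
  forall I, idealr_closed I ->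
    exists xs, forall f, f \in I <-> ideal_generated (fun x => x \in xs) f.

Definition prime_ideal P : Prop := idealr_closed P /\ prime_idealr_closed P.

Definition maximal_ideal P : Prop :=
  idealr_closed P /\
  forall I, idealr_closed I -> {subset P <= I} -> {subset I <= P}.

Definition regular_sequence xs : Prop :=
  (forall (i : nat) (y : R), (i < size xs)%N ->
     ideal_generated (fun x => x \in take i xs) (xs`_i * y) ->
     ideal_generated (fun x => x \in take i xs) y) /\
  ~ ideal_generated (fun x => x \in xs) 1.

Definition is_maximum (Q : nat -> Prop) (n : nat) : Prop :=
  Q n /\ forall m, Q m -> (m <= n)%N.

Definition depth_is P : nat -> Prop :=
  is_maximum (fun n => exists xs,
    [/\ regular_sequence xs, {subset xs <= P} & size xs = n]).

(* Strict chains of primes p 0 < p 1 < ... < p n = P; the values of p beyond n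
   are irrelevant. *)
Definition height_is P : nat -> Prop :=
  is_maximum (fun n => exists p : nat -> {pred R},
    [/\ forall i, (i <= n)%N -> prime_ideal (p i),
        forall i, (i < n)%N ->
          {subset p i <= p i.+1} /\ ~ {subset p i.+1 <= p i}
      & p n =i P]).

(* The definition of Kaplansky and Eisenbud, which avoids localization: for P
   maximal in a noetherian ring, the depth (grade) of P is the depth of the
   local ring R_P, and the height of P is the dimension of R_P. *)
Definition cohen_macaulay : Prop :=
  noetherian /\
  forall P, maximal_ideal P -> exists2 n, depth_is P n & height_is P n.

End CohenMacaulay.

Section Configuration.
Variables (d n : nat) (a : 'I_n -> 'rV[int]_d).

Definition pointed : Prop :=
  forall u : 'I_n -> nat, \sum_i a i *+ u i = 0 -> forall i, u i = 0%N.

(* The rational cone generated by the a_i with i in J. *)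
Definition pos (J : {set 'I_n}) (x : 'rV[rat]_d) : Prop :=
  exists2 lam : 'I_n -> rat,
    forall i, 0 <= lam i &
    x = \sum_(i in J) lam i *: map_mx intr (a i).

(* The rank of the group ZA, i.e. the dimension over rat of its span. *)
Definition rankZ : nat := \rank (\matrix_(i < n) map_mx (intr : int -> rat) (a i)).

Definition simplicial : Prop :=
  exists2 J : {set 'I_n}, #|J| = rankZ & forall x, pos [set: 'I_n] x <-> pos J x.

Definition degA (m : 'X_{1..n}) : 'rV[int]_d := \sum_i a i *+ m i.

Definition semigroup_pred : {pred 'rV[int]_d} :=
  fun x => `[< exists m, x = degA m >].

(* The monoid S. It takes the pointedness proof as a parameter because monalg
   only accepts monoids in which x * y = 1 forces x = y = 1. *)
Record affine_semigroup (ha : pointed) := AffineSemigroup {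
  sgval : 'rV[int]_d;
  sgvalP : sgval \in semigroup_pred
}.

Section Semigroup.
Variable ha : pointed.
Local Notation S := (affine_semigroup ha).

HB.instance Definition _ := [isSub for @sgval ha].
HB.instance Definition _ := [Choice of S by <:].

Fact degA_in m : degA m \in semigroup_pred.
Proof. by apply/asboolP; exists m. Qed.

Definition degS (m : 'X_{1..n}) : S := AffineSemigroup ha (degA_in m).

Fact degA0 : degA 0%MM = 0.
Proof. by rewrite /degA big1 // => i _; rewrite mnm0E. Qed.

Fact degAD m1 m2 : degA (m1 + m2)%MM = degA m1 + degA m2.
Proof.
by rewrite /degA -big_split; apply: eq_bigr => i _; rewrite mnmDE mulrnDr.
Qed.

Fact sg_mul_in (x y : S) : sgval x + sgval y \in semigroup_pred.
Proof.
have /asboolP[m1 ->] := sgvalP x; have /asboolP[m2 ->] := sgvalP y.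
by rewrite -degAD degA_in.
Qed.

Definition sg_one : S := degS 0%MM.
Definition sg_mul (x y : S) : S := AffineSemigroup ha (sg_mul_in x y).

Fact sg_mulC : commutative sg_mul.
Proof. by move=> x y; apply: val_inj; rewrite /= addrC. Qed.

Fact sg_mulA : associative sg_mul.
Proof. by move=> x y z; apply: val_inj; rewrite /= addrA. Qed.

Fact sg_mul1 : left_id sg_one sg_mul.
Proof. by move=> x; apply: val_inj; rewrite /= degA0 add0r. Qed.

Fact sg_mulr1 : right_id sg_one sg_mul.
Proof. by move=> x; rewrite sg_mulC sg_mul1. Qed.

Fact sg_unit x y : sg_mul x y = sg_one -> x = sg_one /\ y = sg_one.
Proof.
move=> /(congr1 val) /= xyE.
have /asboolP[m1 e1] := sgvalP x; have /asboolP[m2 e2] := sgvalP y.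
move: xyE; rewrite e1 e2 degA0 -degAD => /ha m0.
have mD0 i : (m1 i == 0)%N && (m2 i == 0)%N.
  by rewrite -addn_eq0 -mnmDE m0.
have m1_0 : m1 = 0%MM.
  by apply/mnmP => i; case/andP: (mD0 i) => /eqP-> _; rewrite mnm0E.
have m2_0 : m2 = 0%MM.
  by apply/mnmP => i; case/andP: (mD0 i) => _ /eqP->; rewrite mnm0E.
by split; apply: val_inj; rewrite /= ?e1 ?e2 ?m1_0 ?m2_0.
Qed.

HB.instance Definition _ :=
  Choice_isMonomialDef.Build S sg_mulA sg_mul1 sg_mulr1 sg_unit.
HB.instance Definition _ := MonomialDef_isConomialDef.Build S sg_mulC.

Variable k : fieldType.

Definition semigroup_algebra : comNzRingType := malg S k.

Definition toric_map (f : {mpoly k[n]}) : malg S k :=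
  \sum_(m <- msupp f) f@_m *: mkmalgU (degS m) 1.

Definition toric_ideal (f : {mpoly k[n]}) : Prop := toric_map f = 0.

End Semigroup.

Definition leftmost_nonzero_pos (x : 'rV[int]_d) : Prop :=
  exists2 i : 'I_d, 0 < x 0 i & forall j : 'I_d, (j < i)%N -> x 0 j = 0.

(* [le_var i j] means that the i-th variable is at most the j-th one. *)
Definition Agrevlex_lt (le_var : rel 'I_n) (m' m : 'X_{1..n}) : Prop :=
  leftmost_nonzero_pos (degA m - degA m') \/
  degA m = degA m' /\
  exists i : 'I_n, (m i < m' i)%N /\
    forall j, j != i -> le_var j i -> m j = m' j.

End Configuration.

Definition total_order (T : Type) (le : rel T) : Prop :=
  [/\ reflexive le, antisymmetric le, transitive le & total le].

Section InitialIdeal.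
Variables (k : fieldType) (n : nat).
Implicit Types (f g : {mpoly k[n]}) (m : 'X_{1..n}).
Implicit Types (I J : {mpoly k[n]} -> Prop) (G : 'X_{1..n} -> Prop).

Definition leading_monomial (lt : 'X_{1..n} -> 'X_{1..n} -> Prop) f m : Prop :=
  m \in msupp f /\ forall m', m' \in msupp f -> m' != m -> lt m' m.

Definition monomial_ideal G : {mpoly k[n]} -> Prop :=
  ideal_generated (fun g => exists2 m, G m & g = 'X_[m]).

Definition initial_ideal (lt : 'X_{1..n} -> 'X_{1..n} -> Prop) I :=
  monomial_ideal
    (fun m => exists f, [/\ I f, f != 0 & leading_monomial lt f m]).

(* G is the minimal set of monomials generating J; it is unique when J is a
   monomial ideal. *)
Definition minimal_monomial_generators J G : Prop :=
  (forall f, J f <-> monomial_ideal G f) /\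
  forall G', (forall m, G' m -> G m) ->
    (forall f, J f <-> monomial_ideal G' f) -> forall m, G m -> G' m.

End InitialIdeal.

(* Main.v *)
Require Import Defs.
From HB Require Import structures.
From mathcomp Require Import all_boot all_order all_algebra.
From mathcomp Require Import boolp.
From mathcomp Require Import -(notations) monalg.
From mathcomp Require Import mpoly.
From mathcomp Require Import -(notations) finmap.
From mathcomp Require Import ssrcomplements ring zify.
From mathcomp Require classical_sets.
Set Implicit Arguments.
Unset Strict Implicit.
Unset Printing Implicit Defensive.
Import Order.TTheory GRing.Theory Num.Theory.
Local Open Scope ring_scope.

(* Let M be a common denominator of the coordinates of the b_j with respect to
   a_1, ..., a_r. Multiplying these coordinates by M embeds S in N^r, with a_i
   sent to M e_i, and k[S] in k[X_1, ..., X_r].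

   A monomial lies in the initial ideal iff it is non-standard, i.e. not the
   smallest monomial of its degree. If the minimal generators do not involve
   Y, multiplication by Y_i preserves standard monomials, so that the normal
   form is a k[Y]-linear section of k[Y, Z] -> k[S]. By Zariski's lemma a
   maximal ideal P contains nonzero f_1(Y_1), ..., f_r(Y_r); this sequence is
   regular on k[Y, Z], hence on k[S]. Regular sequences in P yield chains of
   primes below P, and chains of primes have length at most r because any r + 1
   elements of k[S] are algebraically dependent, so depth and height of P are r.

   Conversely, if k[S] is Cohen-Macaulay, the ideal of the nonzero elements of S
   has height r and contains a regular sequence f_1, ..., f_r. If x is not in S
   but x + a_i and x + a_j are, the ideal of the h with h chi^x in k[S] contains,
   by counting dimensions, for each t a nonzero polynomial Q_t in the f_l with
   l <> t. Comparing lowest monomials in Q_t (Q_0 chi^x) = Q_0 (Q_t chi^x),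
   quasi-regularity of f shows that Q_0 divides Q_0 chi^x to any order, which is
   absurd in a graded domain. Hence x + a_i, x + a_j in S imply x in S, and this
   makes every minimal non-standard monomial free of Y. *)

(** * Ideals, prime avoidance and chains of primes *)

Section Ideals.
Variable R : comNzRingType.
Implicit Types (X J T : R -> Prop) (P : {pred R}) (xs : seq R).

(** Unlike [idealr_closed], this allows the unit ideal, so that every generated ideal qualifies. *)
Definition ideal J : Prop := J 0 /\ forall a x y, J x -> J y -> J (a * x + y).

Lemma idealM J a x : ideal J -> J x -> J (a * x).
Proof. by case=> J0 JMD Jx; rewrite -[_ * _]addr0; apply: JMD. Qed.

Lemma idealD J x y : ideal J -> J x -> J y -> J (x + y).
Proof. by case=> _ JMD Jx Jy; rewrite -[x]mul1r; apply: JMD. Qed.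

Lemma idealB J x y : ideal J -> J x -> J y -> J (x - y).
Proof. by case=> _ JMD Jx Jy; rewrite -mulN1r addrC; apply: JMD. Qed.

Lemma ideal_sum J (I : Type) (r : seq I) (Q : pred I) (F : I -> R) :
  ideal J -> (forall i, Q i -> J (F i)) -> J (\sum_(i <- r | Q i) F i).
Proof.
move=> idJ JF; elim/big_rec: _ => [|i x Qi Jx]; first by case: idJ.
by apply: idealD => //; apply: JF.
Qed.

Lemma ideal_generated_ideal X : ideal (ideal_generated X).
Proof.
split=> [|a x y [c Xc ->] [e Xe ->]].
  by exists [::] => //; rewrite big_nil.
exists ([seq (a * p.1, p.2) | p <- c] ++ e).
  by move=> p; rewrite mem_cat => /orP[/mapP[q qc ->]|/Xe //]; exact: (Xc q).
rewrite big_cat big_map /= mulr_sumr; congr (_ + _).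
by apply: eq_bigr => p _; rewrite mulrA.
Qed.

Lemma sub_ideal_generated X x : X x -> ideal_generated X x.
Proof.
move=> Xx; exists [:: (1, x)]; first by move=> p; rewrite inE => /eqP->.
by rewrite big_seq1 mul1r.
Qed.

Lemma ideal_generated_min X J f :
  ideal J -> (forall x, X x -> J x) -> ideal_generated X f -> J f.
Proof.
move=> idJ XJ [c Xc ->]; rewrite big_seq; apply: ideal_sum => // p pc.
by apply: idealM => //; apply/XJ/Xc.
Qed.

Lemma idealr_ideal P : idealr_closed P -> ideal (fun x => x \in P).
Proof. by case=> P0 _ PMD; split=> // a x y; apply: PMD. Qed.

Lemma maximal_inv P u : maximal_ideal P -> u \notin P -> exists a, 1 - a * u \in P.
Proof.
case=> idP maxP uP; apply: contrapT => noinv.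
have idP' := idealr_ideal idP; have [P0 P1 PMD] := idP.
(* I is the ideal P + (u); without an inverse of u modulo P it would be proper and larger than P. *)
pose I : {pred R} := fun x => `[< exists a, x - a * u \in P >].
have sPI x : x \in P -> x \in I.
  by move=> xP; apply/asboolP; exists 0; rewrite mul0r subr0.
have /maxP/(_ sPI)/(_ u) : idealr_closed I.
  split; first exact: sPI.
    by apply/asboolP=> -[a aP]; apply: noinv; exists a.
  move=> c x y /asboolP[a xP] /asboolP[b yP]; apply/asboolP.
  exists (c * a + b).
  rewrite mulrDl -mulrA opprD addrACA -mulrBr; exact: PMD.
rewrite (negPf uP) => noI; suff: false by [].
by apply: noI; apply/asboolP; exists 1; rewrite mul1r subrr.
Qed.

Lemma maximal_prime P : maximal_ideal P -> prime_ideal P.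
Proof.
move=> maxP; have [idP _] := maxP; split=> // u v uvP.
have idP' := idealr_ideal idP.
case: (boolP (u \in P)) => //= uP; have [a aP] := maximal_inv maxP uP.
have -> : v = v * (1 - a * u) + a * (u * v).
  by rewrite mulrBr mulr1 [v * _]mulrC -mulrA subrK.
by apply: (idealD idP'); apply: (idealM _ idP').
Qed.

(** By Zorn's lemma some ideal is maximal among those that contain J and avoid the multiplicative
    set T; such an ideal is prime. *)
Lemma prime_avoiding J T :
    ideal J -> T 1 -> (forall x y, T x -> T y -> T (x * y)) ->
    (forall x, T x -> ~ J x) ->
  exists P : {pred R},
    [/\ prime_ideal P, forall x, J x -> x \in P & forall x, T x -> x \notin P].
Proof.
move=> idJ T1 TM TJ.
pose good (A : R -> Prop) :=
  [/\ ideal A, forall x, J x -> A x & forall x, T x -> ~ A x].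
have [|A [A0orgood Amax]] :=
    @classical_sets.Zorn_bigcup R (fun A => (forall x, ~ A x) \/ good A).
  move=> F Fgood Ftot.
  have [[X FX gX]|noX] := pselect (exists2 X, F X & good X); last first.
    left=> x [X FX Xx]; case: (Fgood X FX) => [/(_ x)//|gX].
    by apply: noX; exists X.
  right; split; last 2 first.
  - by move=> x Jx; exists X => //; case: gX => _ + _; apply.
  - move=> x Tx [Y FY Yx]; case: (Fgood Y FY) => [/(_ x)//|[_ _ /(_ x Tx)]].
    by apply.
  split; first by exists X => //; case: gX => -[].
  move=> a x y [Y FY Yx] [Z FZ Zy].
  have [W [FW Wx Wy]] : exists W, [/\ F W, W x & W y].
    case: (Ftot _ _ FY FZ) => [YZ|ZY].
      by exists Z; split=> //; apply: YZ.
    by exists Y; split=> //; apply: ZY.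
  exists W => //; case: (Fgood W FW) => [/(_ x)//|[[_ WMD] _ _]].
  exact: WMD.
have goodJ : good J by split.
have gA : good A.
  case: A0orgood => // A0; exfalso; apply: (Amax J); last by right.
  split=> [x /A0 //|/(_ 0) J0]; apply: (A0 0); apply: J0.
  by case: idJ.
have [idA JA TA] := gA.
(* For u outside A the ideal A + (u) is strictly larger than A, so it meets T. *)
have ext u : ~ A u -> exists2 a, A a & exists b, T (a + b * u).
  move=> Au; apply: contrapT => notT.
  pose B x := exists2 a, A a & exists b, x = a + b * u.
  apply: (Amax B); first split.
  - by move=> x Ax; exists x => //; exists 0; rewrite mul0r addr0.
  - move=> BA; apply/Au/BA; exists 0; first by case: idA.
    by exists 1; rewrite mul1r add0r.
  right; split.
  - split; first by exists 0; [case: idA | exists 0; rewrite mul0r addr0].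
    move=> c x y [a Aa [b ->]] [a' Aa' [b' ->]].
    exists (c * a + a'); first by case: idA => _; apply.
    by exists (c * b + b'); rewrite mulrDr mulrDl mulrA addrACA.
  - by move=> x /JA Ax; exists x => //; exists 0; rewrite mul0r addr0.
  - by move=> x Tx [a Aa [b xE]]; apply: notT; exists a => //; exists b; rewrite -xE.
exists (fun x => `[< A x >]); split; last 2 first.
- by move=> x /JA Ax; apply/asboolP.
- by move=> x Tx; apply/asboolP; apply: TA.
split=> [|u v /asboolP Auv].
  split; first by apply/asboolP; case: idA.
    by apply/asboolP; apply: TA.
  move=> a x y /asboolP Ax /asboolP Ay; apply/asboolP.
  by case: idA => _; apply.
rewrite -[_ || _]negbK negb_or; apply/negP => /andP[/asboolP Au /asboolP Av].
(* The product of these elements of A + (u) and A + (v) lies in T and in A + (uv), which is A. *)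
have [a Aa [b T1']] := ext u Au; have [c Ac [e T2]] := ext v Av.
apply: (TA _ (TM _ _ T1' T2)).
rewrite mulrDl mulrDr; apply: (idealD idA).
  by apply: (idealD idA); rewrite mulrC; apply: idealM.
rewrite mulrDr mulrACA; apply: (idealD idA); exact: idealM.
Qed.

(* The multiplicative set generated by x_i and the complement of P avoids
   (x_0, ..., x_(i-1)), as x_i is regular modulo that ideal. *)
Lemma regular_sequence_chain xs P :
    prime_ideal P -> regular_sequence xs -> {subset xs <= P} ->
  exists p : nat -> {pred R},
    [/\ forall i, (i <= size xs)%N -> prime_ideal (p i),
        forall i, (i < size xs)%N ->
          {subset p i <= p i.+1} /\ ~ {subset p i.+1 <= p i}
      & p (size xs) =i P].
Proof.
move=> primeP [reg _] xsP.
(* The chain is built downwards: the prime found below Q contains the first i elements of [xs] but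
   not the next one, and the induction continues below it. *)
suff chain i : (i <= size xs)%N -> forall Q : {pred R}, prime_ideal Q ->
    {subset take i xs <= Q} -> exists p : nat -> {pred R},
    [/\ forall j, (j <= i)%N -> prime_ideal (p j),
        forall j, (j < i)%N ->
          {subset p j <= p j.+1} /\ ~ {subset p j.+1 <= p j}
      & p i =i Q].
  by apply: chain => //; rewrite take_size.
elim: i => [|i IH] ilt Q primeQ xsQ; first by exists (fun=> Q).
pose J := ideal_generated (fun x => x \in take i xs).
have idJ : ideal J := ideal_generated_ideal _.
have [[Q0 Q1 QMD] Qpr] := primeQ.
have idQ : ideal (fun x => x \in Q) by split.
have JQ x : J x -> x \in Q.
  apply: (ideal_generated_min (J := fun x => x \in Q)) => // y yi.
  by apply: xsQ; rewrite (take_nth 0) // mem_rcons inE yi orbT.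
pose T y := exists2 s, s \notin Q & exists n, y = s * xs`_i ^+ n.
have [|_ _ [s sQ [n ->]] [t tQ [m ->]]|_ [s sQ [n ->]]|Q' [primeQ' JQ' TQ']] :=
    @prime_avoiding J T idJ.
- by exists 1 => //; exists 0%N; rewrite mulr1.
- exists (s * t); first by apply/negP => /Qpr; rewrite (negPf sQ) (negPf tQ).
  by exists (n + m)%N; rewrite exprD mulrACA.
- elim: n => [|n IHn] Jn; first by case/negP: sQ; apply: JQ; rewrite mulr1 in Jn.
  by apply/IHn/reg => //; move: Jn; rewrite exprS mulrCA.
have [|p [pprime pstrict pi]] := IH (ltnW ilt) Q' primeQ'.
  by move=> x xi; apply/JQ'/sub_ideal_generated.
have xQ : xs`_i \in Q.
  by apply: xsQ; rewrite (take_nth 0) // mem_rcons mem_head.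
have xQ' : xs`_i \notin Q'.
  by apply: TQ'; exists 1 => //; exists 1%N; rewrite mul1r.
have sQ'Q : {subset Q' <= Q}.
  move=> x; apply: contraTT => xnQ; apply: TQ'; exists x => //.
  by exists 0%N; rewrite mulr1.
exists (fun j => if (j <= i)%N then p j else Q); split=> [j|j|].
- by case: (leqP j i) => [ji _|//]; apply: pprime.
- rewrite ltnS; case: (ltngtP j i) => // [ji _|-> _]; first exact: pstrict.
  split=> [x|/(_ _ xQ)]; first by rewrite pi; apply: sQ'Q.
  by rewrite pi (negPf xQ').
- by rewrite ltnn.
Qed.

End Ideals.

(** * Powers of a regular sequence *)

Section PowerIdeals.
Variables (R : comNzRingType) (f : nat -> R).
Implicit Types (a b c : nat -> nat) (i j t : nat) (x y z : R).

Definition power_ideal i a x : Prop :=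
  exists e : nat -> R, x = \sum_(j < i) e j * f j ^+ a j.

Definition set_exponent a t n : nat -> nat := fun j => if j == t then n else a j.

Lemma power_ideal_ideal i a : ideal (power_ideal i a).
Proof.
split=> [|u x y [e ->] [g ->]].
  by exists (fun=> 0); rewrite big1 // => j _; rewrite mul0r.
exists (fun j => u * e j + g j); rewrite mulr_sumr -big_split /=.
by apply: eq_bigr => j _; rewrite mulrDl mulrA.
Qed.

Lemma power_ideal_gen i a t : (t < i)%N -> power_ideal i a (f t ^+ a t).
Proof.
move=> ti; exists (fun j => (j == t)%:R).
rewrite (bigD1 (Ordinal ti)) //= eqxx mul1r big1 ?addr0 // => j jt.
by rewrite -val_eqE /= in jt; rewrite (negPf jt) mul0r.
Qed.

Lemma power_idealW i a b x :
  (forall j, (j < i)%N -> (a j <= b j)%N) -> power_ideal i b x -> power_ideal i a x.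
Proof.
move=> ab [e ->]; exists (fun j => e j * f j ^+ (b j - a j)).
by apply: eq_bigr => j _; rewrite -mulrA -exprD subnK // ab.
Qed.

Lemma power_idealS i a x :
  power_ideal i.+1 a x <-> exists z, power_ideal i a (x - z * f i ^+ a i).
Proof.
split=> [[e ->]|[z [e xE]]].
  by exists (e i), e; rewrite big_ord_recr /= addrK.
exists (fun j => if j == i then z else e j).
rewrite big_ord_recr /= eqxx -[x in LHS](subrK (z * f i ^+ a i)) xE.
by congr (_ + _); apply: eq_bigr => j _; rewrite (ltn_eqF (ltn_ord j)).
Qed.

Lemma power_ideal_split i a t x : (t < i)%N -> power_ideal i a x ->
  exists z, forall n, power_ideal i (set_exponent a t n) (x - z * f t ^+ a t).
Proof.
move=> ti [e ->]; exists (e t) => n; exists (fun j => if j == t then 0 else e j).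
rewrite (bigD1 (Ordinal ti)) //= addrAC subrr add0r [RHS](bigD1 (Ordinal ti)) //= eqxx mul0r add0r.
apply: eq_bigr => j jt; rewrite /set_exponent.
by rewrite -val_eqE /= in jt; rewrite (negPf jt).
Qed.

Definition regular_mod_powers i : Prop :=
  forall a x, power_ideal i a (f i * x) -> power_ideal i a x.

(** A colon identity known for independent variables: cancelling [f t] lowers the exponent at t by
    one. *)
Definition colon_powers i : Prop := forall a t x, (t < i)%N ->
  power_ideal i (set_exponent a t (a t).+1) (f t * x) -> power_ideal i a x.

Lemma regular_mod_powersX i n a x : regular_mod_powers i ->
  power_ideal i a (f i ^+ n * x) -> power_ideal i a x.
Proof.
by move=> reg; elim: n => [|n IH]; rewrite ?mul1r // exprS -mulrA => /reg.
Qed.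

Lemma colon_powersX i n a t x : colon_powers i -> (t < i)%N ->
  power_ideal i (set_exponent a t (a t + n)%N) (f t ^+ n * x) -> power_ideal i a x.
Proof.
move=> col ti; elim: n a => [|n IH] a.
  rewrite mul1r => H; apply: power_idealW H => j _.
  by rewrite /set_exponent addn0; case: eqP => [->|].
move=> H; apply: IH; apply: (col _ t) => //; rewrite mulrA -exprS.
apply: power_idealW H => j _; rewrite /set_exponent eqxx.
by case: eqP => // _; rewrite addnS.
Qed.

(** Write [f t * y] as [z * f i ^+ a i] modulo the powers of the earlier elements. If t = i, one
    factor [f i] is cancelled; otherwise z is a multiple of [f t] up to harmless terms, and [f t] is
    cancelled. *)
Lemma colon_powersS i :
  regular_mod_powers i -> colon_powers i -> colon_powers i.+1.
Proof.
move=> reg col a t y; have idJ b := power_ideal_ideal i b.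
rewrite ltnS leq_eqVlt => /orP[/eqP->|ti] /power_idealS[z Hz]; apply/power_idealS.
  exists z; apply: reg; rewrite mulrBr mulrCA -exprS.
  rewrite {2}/set_exponent eqxx in Hz.
  by apply: power_idealW Hz => j ji; rewrite /set_exponent (ltn_eqF ji).
have tE : set_exponent a t (a t).+1 i = a i.
  by rewrite /set_exponent gtn_eqF.
rewrite tE in Hz.
(* With exponent 1 at t, [f t * y] itself is in the ideal, so [z * f i ^+ a i] is too, and
   regularity of [f i] puts z there. *)
pose b := set_exponent a t 1.
have bt : b t = 1%N by rewrite /b /set_exponent eqxx.
have : power_ideal i b z.
  apply: (regular_mod_powersX (n := a i)) => //; rewrite mulrC.
  rewrite -[_ * _](subKr (f t * y)); apply: idealB => //.
    rewrite mulrC; apply: idealM => //.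
    by have := power_ideal_gen b ti; rewrite bt.
  apply: power_idealW Hz => j _; rewrite /b /set_exponent.
  by case: eqP.
case/(power_ideal_split ti) => z' Hz'; exists z'.
apply: (col _ t) => //.
have -> : f t * (y - z' * f i ^+ a i) =
    (f t * y - z * f i ^+ a i) + f i ^+ a i * (z - z' * f t ^+ b t).
  by rewrite bt expr1; ring.
apply: idealD => //; apply: idealM => //.
apply: power_idealW (Hz' (a t).+1) => j _; rewrite /b /set_exponent.
by case: eqP.
Qed.

(** Induction on the sum of the exponents. If some [a t] exceeds 1, lowering it gives x = z f_t^(a_t
    - 1) modulo the ideal; the colon property and induction with exponent 1 at t show that z is a
    multiple of [f t]. Exponents all equal to 1 are the hypothesis, and an exponent 0 gives the unit
    ideal. *)
Lemma regular_mod_powers_colon i :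
    (forall x, power_ideal i (fun=> 1%N) (f i * x) -> power_ideal i (fun=> 1%N) x) ->
  colon_powers i -> regular_mod_powers i.
Proof.
move=> reg1 col a; have idJ b := power_ideal_ideal i b.
have [n] := ubnP (\sum_(j < i) a j); elim: n a => // n IH a an x Hx.
have [[t t0]|no0] := pselect (exists t : 'I_i, a t = 0%N).
  by have := idealM x (idJ a) (power_ideal_gen a (ltn_ord t)); rewrite t0 mulr1.
have [[t t2]|no2] := pselect (exists t : 'I_i, (1 < a t)%N); last first.
  have a1 j : (j < i)%N -> a j = 1%N.
    move=> ji; case aj: (a j) => [|[|m]] //.
      by case: no0; exists (Ordinal ji).
    by case: no2; exists (Ordinal ji); rewrite aj.
  apply: (@power_idealW _ _ (fun=> 1%N)) => [j /a1->//|].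
  by apply: reg1; apply: power_idealW Hx => j /a1->.
have ti := ltn_ord t.
have sumU m : (m < a t)%N -> (\sum_(j < i) set_exponent a t m j < n)%N.
  move=> ma; rewrite -ltnS; apply: leq_trans an; rewrite ltnS (bigD1 t) //=.
  rewrite [X in (_ < X)%N](bigD1 t) //= /set_exponent eqxx -addSn.
  apply: leq_add => //; apply: leq_sum => j jt.
  by rewrite -val_eqE /= in jt; rewrite (negPf jt).
have at0 : (a t).-1.+1 = a t by rewrite prednK // ltnW.
have : power_ideal i (set_exponent a t (a t).-1) x.
  apply: IH; first by apply: sumU; rewrite at0.
  apply: power_idealW Hx => j _; rewrite /set_exponent.
  by case: eqP => [->|_] //; rewrite leq_pred.
case/(power_ideal_split ti) => z /(_ (a t)).
have -> : set_exponent a t (a t).-1 t = (a t).-1 by rewrite /set_exponent eqxx.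
move=> Hz.
have {}Hz : power_ideal i a (x - z * f t ^+ (a t).-1).
  apply: power_idealW Hz => j _; rewrite /set_exponent.
  by case: eqP => [->|].
rewrite -[x](subrK (z * f t ^+ (a t).-1)); apply: idealD => //.
pose b := set_exponent a t 1.
have bt : b t = 1%N by rewrite /b /set_exponent eqxx.
have : power_ideal i b z.
  apply: IH; first exact: sumU.
  apply: (colon_powersX (n := (a t).-1) col ti).
  rewrite bt add1n at0.
  apply: (@power_idealW _ _ a) => [j _|].
    by rewrite /b /set_exponent; case: eqP => [->|].
  have -> : f t ^+ (a t).-1 * (f i * z) = f i * x - f i * (x - z * f t ^+ (a t).-1).
    by rewrite -mulrBr subKr mulrCA [f t ^+ _ * _]mulrC.
  by apply: idealB => //; apply: idealM.
case/(power_ideal_split ti) => z' /(_ (a t)); rewrite bt expr1 => Hz'.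
rewrite -[z](subrK (z' * f t)) mulrDl; apply: idealD => //.
  rewrite mulrC; apply: idealM => //.
  by apply: power_idealW Hz' => j _; rewrite /b /set_exponent; case: eqP => [->|].
rewrite -mulrA -exprS at0; apply: idealM => //; exact: power_ideal_gen.
Qed.

Lemma regular_colon_powers r :
    (forall i, (i < r)%N -> forall x,
       power_ideal i (fun=> 1%N) (f i * x) -> power_ideal i (fun=> 1%N) x) ->
  colon_powers r.
Proof.
elim: r => [|r IH] reg //.
have col : colon_powers r by apply: IH => i ir; apply/reg/ltnW.
by apply: colon_powersS => //; apply: regular_mod_powers_colon => //; apply: reg.
Qed.

Lemma colon_powers_monomial r a b x : colon_powers r ->
  power_ideal r (fun j => a j + b j)%N ((\prod_(j < r) f j ^+ b j) * x) ->
  power_ideal r a x.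
Proof.
move=> col H.
suff prefix n : (n <= r)%N -> power_ideal r (fun j => if j < n then a j + b j else a j)%N
    ((\prod_(j < n) f j ^+ b j) * x) -> power_ideal r a x.
  by apply: (prefix r) => //; apply: power_idealW H => j ->.
elim: n => [|n IH] nr; first by rewrite big_ord0 mul1r.
rewrite big_ord_recr /= => Hn; apply: IH; first exact: ltnW.
apply: (colon_powersX (n := b n) col nr); rewrite mulrA [f n ^+ _ * _]mulrC.
apply: power_idealW Hn => j _; rewrite /set_exponent ltnn ltnS.
by case: (ltngtP j n) => [||->].
Qed.

(* Quasi-regularity: modulo the ideal (f_j^(m_j + 1)) only the monomial m
   survives, and it can be cancelled. *)
Lemma minimal_coeff_power_ideal r (p : {mpoly R[r]}) (m : 'X_{1..r}) :
    colon_powers r -> p.@[fun i : 'I_r => f i] = 0 ->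
    (forall m', m' \in msupp p -> m' != m -> ~~ (m' <= m)%MM) ->
  power_ideal r (fun=> 1%N) p@_m.
Proof.
move=> col p0 mmin; set b := fun j => nth 0%N m j.
have mE (i : 'I_r) : m i = b i by rewrite /b -mnm_nth.
apply: (colon_powers_monomial (b := b)) => //.
have idJ := power_ideal_ideal r (fun j => 1 + b j)%N.
have [mp|/memN_msupp_eq0->] := boolP (m \in msupp p); last by rewrite mulr0; case: idJ.
move: p0; rewrite mevalE (bigD1_seq m) ?msupp_uniq //= mulrC => /eqP.
rewrite addr_eq0 => /eqP.
under eq_bigr do rewrite mE.
move=> ->; rewrite -mulN1r; apply: idealM => //.
rewrite big_seq_cond; apply: ideal_sum => // m' /andP[m'p m'm].
have /negP := mmin m' m'p m'm => nle.
have [i mi] : exists i : 'I_r, (m i < m' i)%N.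
  apply: contrapT => noi; apply: nle; apply/mnm_lepP => i.
  by rewrite leqNgt; apply/negP => mi; apply: noi; exists i.
apply: idealM => //; rewrite (bigD1 i) //= mulrC; apply: idealM => //.
rewrite -(subnK mi) exprD; apply: idealM => //.
by have := power_ideal_gen (fun j => 1 + b j)%N (ltn_ord i); rewrite -mE.
Qed.

End PowerIdeals.

Lemma ideal_generated_power (R : comNzRingType) (xs : seq R) i x : (i <= size xs)%N ->
  ideal_generated (fun y => y \in take i xs) x <->
  power_ideal (fun j => xs`_j) i (fun=> 1%N) x.
Proof.
move=> ixs; have idJ := power_ideal_ideal (fun j => xs`_j) i (fun=> 1%N).
split=> [|[e ->]].
  apply: ideal_generated_min => // y /(nthP 0)[j].
  rewrite size_takel // => ji <-; rewrite nth_take //.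
  by have := power_ideal_gen (fun j => xs`_j) (fun=> 1%N) ji.
apply: ideal_sum => [|j _]; first exact: ideal_generated_ideal.
apply: idealM; first exact: ideal_generated_ideal.
apply: sub_ideal_generated; rewrite expr1 -(nth_take 0 (ltn_ord j)).
by apply: mem_nth; rewrite size_takel.
Qed.

(** * Algebraic dependence by counting monomials *)

Lemma mmap1D n (S : comNzRingType) (h : 'I_n -> S) m1 m2 :
  mmap1 h (m1 + m2)%MM = mmap1 h m1 * mmap1 h m2.
Proof. by apply: commr_mmap1_M => i x; apply: mulrC. Qed.

Lemma mmap1Mn n (S : comNzRingType) (h : 'I_n -> S) m e :
  mmap1 h (m *+ e)%MM = mmap1 h m ^+ e.
Proof.
elim: e => [|e IH]; first by rewrite mulm0n mmap11.
by rewrite mulmS mmap1D IH exprS.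
Qed.

Lemma mdeg_ge_coord n (m : 'X_{1..n}) i : (m i <= mdeg m)%N.
Proof. by rewrite mdegE (bigD1 i) //= leq_addr. Qed.

Lemma mdeg_msuppM n (R : comNzRingType) (x y : {mpoly R[n]}) (a b : nat) :
    (forall m, m \in msupp x -> (mdeg m <= a)%N) ->
    (forall m, m \in msupp y -> (mdeg m <= b)%N) ->
  forall m, m \in msupp (x * y) -> (mdeg m <= a + b)%N.
Proof.
move=> xa yb m /msuppM_le/allpairsP[[m1 m2] /= [m1x m2y ->]].
by rewrite mdegD leq_add ?xa ?yb.
Qed.

Section AlgebraicDependence.
Variables (k : fieldType) (p r : nat).
Implicit Types (g : 'I_p -> {mpoly k[r]}) (m s : 'X_{1..r}).

Lemma mdeg_msupp_mmap1 g D (b : 'X_{1..p}) :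
    (forall i m, m \in msupp (g i) -> (mdeg m <= D)%N) ->
  forall m, m \in msupp (mmap1 g b) -> (mdeg m <= mdeg b * D)%N.
Proof.
move=> gD; rewrite /mmap1 mdegE big_distrl /=.
apply: (big_rec2 (fun x n => forall m, m \in msupp x -> (mdeg m <= n)%N)) => [m|i n x _ IH].
  by rewrite msupp1 inE => /eqP->; rewrite mdeg0.
apply: mdeg_msuppM => //; elim: (b i) => [|c IHc] m.
  by rewrite expr0 msupp1 inE => /eqP->; rewrite mdeg0.
by rewrite exprS mulSn; apply: mdeg_msuppM m; [apply: gD|].
Qed.

(* There are N^#|K| monomials in the variables of K with exponents below N,
   while the exponents s where a coefficient must vanish are O(N^#|J|). *)
Lemma vanishing_combination g (K : {set 'I_p}) (J : {set 'I_r}) C :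
    (#|J| < #|K|)%N ->
  exists Q : {mpoly k[p]},
    [/\ Q != 0, forall b, b \in msupp Q -> forall i, i \notin K -> b i = 0%N
      & forall s, (forall i, i \notin J -> (s i < C)%N) ->
          (mmap (@mpolyC r k) g Q)@_s = 0].
Proof.
move=> JK; pose D := (\max_i msize (g i))%N.
have gD i m : m \in msupp (g i) -> (mdeg m <= D)%N.
  move=> /msize_mdeg_lt/ltnW/leq_trans; apply.
  exact: (leq_bigmax (F := fun i => msize (g i))).
(* N is chosen so that N^(#|J| + 1) exceeds the bound on the number of columns, and L so that no
   monomial in the products considered has an exponent reaching L. *)
pose N := ((C.+1 ^ r) * (p * D + 1) ^ #|J|).+1.
pose L := (p * N * D).+1.
pose rows := family (fun i : 'I_p => if i \in K then predT else pred1 (ord0 : 'I_N)).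
pose cols := family (fun i : 'I_r => if i \in J then predT else [pred x : 'I_L | (x < C)%N]).
have card_rows : #|rows| = (N ^ #|K|)%N.
  rewrite card_family foldrE big_map big_enum /= (bigID (mem K)) /=.
  rewrite [X in (_ * X)%N]big1 => [|i /negPf->]; last by rewrite card1.
  under eq_bigr => i iK do rewrite iK card_ord.
  by rewrite muln1 prod_nat_const.
have card_cols : (#|cols| <= L ^ #|J| * C.+1 ^ r)%N.
  rewrite card_family foldrE big_map big_enum /= (bigID (mem J)) /=.
  apply: leq_mul.
    under eq_bigr => i iJ do rewrite iJ card_ord.
    by rewrite prod_nat_const.
  apply: (@leq_trans (\prod_(i in ~: J) C.+1)%N).
    under [X in (_ <= X)%N]eq_bigl => i do rewrite inE.
    apply: leq_prod => i /negPf->.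
    rewrite -[X in (_ <= X)%N]card_ord.
    rewrite -(card_in_image (f := fun x : 'I_L => inord x : 'I_C.+1)) ?max_card //.
    move=> x y; rewrite !inE => xC yC /(congr1 val).
    by rewrite /= !inordK ?(ltnW xC) ?(ltnW yC) ?ltnS 1?ltnW //; apply: val_inj.
  rewrite prod_nat_const leq_pexp2l // -[X in (_ <= X)%N](card_ord r).
  exact: max_card.
have lt_cols_rows : (#|cols| < #|rows|)%N.
  rewrite card_rows; apply: leq_ltn_trans card_cols _.
  apply: (@leq_trans (N ^ #|J|.+1)%N); last by rewrite leq_pexp2l.
  have LN : (L <= N * (p * D + 1))%N by rewrite /L; nia.
  apply: (@leq_ltn_trans ((N * (p * D + 1)) ^ #|J| * C.+1 ^ r)%N).
    rewrite leq_mul2r; case: #|J| => [|e]; first by rewrite !expn0 leqnn orbT.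
    by rewrite leq_exp2r // LN orbT.
  rewrite expnMn expnSr -mulnA ltn_pmul2l ?expn_gt0 // mulnC.
  exact: ltnSn.
pose mon n a (x : {ffun 'I_n -> 'I_a}) : 'X_{1..n} := [multinom x i : nat | i < n].
have mon_inj n a : injective (@mon n a).
  move=> x y xy; apply/ffunP => i; apply: val_inj.
  by have /mnmP/(_ i) := xy; rewrite !mnmE.
pose row_mon (a : 'I_#|rows|) := mon _ _ (enum_val a).
(* Rows are monomials in the g_i, columns the coefficients that must vanish; having more rows than
   columns, the matrix has a nonzero left kernel. *)
pose A : 'M[k]_(#|rows|, #|cols|) :=
  \matrix_(a, b) (mmap1 g (row_mon a))@_(mon _ _ (enum_val b)).
have kerA : kermx A != 0.
  by rewrite kermx_eq0 /row_free neq_ltn (leq_ltn_trans (rank_leq_col A)).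
have [v vA v0] : exists2 v : 'rV_#|rows|, v *m A = 0 & v != 0.
  have /rowV0Pn[v /sub_kermxP vA v0] := kerA.
  by exists v.
pose Q : {mpoly k[p]} := \sum_a v 0 a *: 'X_[row_mon a].
have row_mon_inj : injective row_mon.
  by move=> a b /mon_inj/enum_val_inj.
have Qcoef a : Q@_(row_mon a) = v 0 a.
  rewrite raddf_sum (bigD1 a) //= mcoeffZ mcoeffX eqxx mulr1 big1 ?addr0 // => b ba.
  by rewrite mcoeffZ mcoeffX (inj_eq row_mon_inj) (negPf ba) mulr0.
have Qsupp b : b \in msupp Q -> exists a, b = row_mon a.
  move=> bQ; apply: contrapT => nob; move: bQ; rewrite mcoeff_msupp raddf_sum big1 ?eqxx //.
  move=> a _; rewrite /= mcoeffZ mcoeffX; case: eqP => [ab|_]; last by rewrite mulr0.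
  by case: nob; exists a.
exists Q; split=> [|b /Qsupp[a ->] i iK|s sC].
- apply: contra v0 => /eqP Q0; apply/eqP/rowP => a.
  by rewrite mxE -Qcoef Q0 mcoeff0.
- rewrite mnmE; have /familyP/(_ i) := enum_valP a.
  by rewrite (negPf iK) inE => /eqP->.
have -> : mmap (@mpolyC r k) g Q = \sum_a v 0 a *: mmap1 g (row_mon a).
  by rewrite raddf_sum; apply: eq_bigr => a _; rewrite /= mmapZ mmapX mul_mpolyC.
rewrite raddf_sum /=; under eq_bigr do rewrite mcoeffZ.
(* If some exponent of s is at least L, the coefficient vanishes for degree reasons; otherwise s is
   a column. *)
have [sL|] := pselect (forall i, (s i < L)%N); last first.
  move=> /existsNP[i /negP]; rewrite -leqNgt => Ls.
  rewrite big1 // => a _; rewrite memN_msupp_eq0 ?mulr0 //.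
  apply/negP => /(mdeg_msupp_mmap1 gD); apply/negP; rewrite -ltnNge.
  apply: leq_trans (mdeg_ge_coord s i); apply: leq_trans Ls; rewrite ltnS.
  rewrite leq_mul2r mdegE (leq_trans (n := (\sum_(j < p) N)%N)) ?orbT //.
    by apply: leq_sum => j _; rewrite mnmE ltnW.
  by rewrite sum_nat_const card_ord.
pose t : {ffun 'I_r -> 'I_L} := [ffun i => Ordinal (sL i)].
have tcols : t \in cols.
  apply/familyP => i; rewrite ffunE; case: ifP => // /negbT iJ.
  by rewrite inE /= sC.
have sE : s = mon _ _ (enum_val (enum_rank_in tcols t)).
  by rewrite enum_rankK_in //; apply/mnmP => i; rewrite mnmE ffunE.
have /rowP/(_ (enum_rank_in tcols t)) := vA; rewrite !mxE => vA0.
by rewrite -[RHS]vA0; apply: eq_bigr => a _; rewrite mxE -sE.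
Qed.

End AlgebraicDependence.

(** * Lengths of chains of primes and algebraic independence *)

Section KrullDimension.
Variables (k : fieldType) (R : comNzRingType) (cst : {rmorphism k -> R}).

Lemma rmorph_unit_notin (P : {pred R}) c :
  idealr_closed P -> c != 0 -> cst c \notin P.
Proof.
move=> idP c0; have idP' := idealr_ideal idP; have [_ P1 _] := idP.
apply: contra P1 => cP.
by rewrite -(rmorph1 cst) -(mulVf c0) rmorphM; apply: (idealM _ idP').
Qed.

(* If e is the least exponent of X_i in Q, then Q = X_i^e (Q' + X_i Q'') with Q'
   nonzero and free of X_i. *)
Lemma eliminate_variable n (x : 'I_n -> R) (P P' : {pred R}) (i : 'I_n)
    (Q : {mpoly k[n]}) :
    prime_ideal P -> prime_ideal P' -> {subset P <= P'} ->
    x i \notin P -> x i \in P' -> Q != 0 -> mmap cst x Q \in P ->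
  exists Q' : {mpoly k[n]}, [/\ Q' != 0, mmap cst x Q' \in P' &
    forall m, m \in msupp Q' -> m i = 0%N /\
      exists2 m', m' \in msupp Q & forall j, j != i -> m j = m' j].
Proof.
move=> [idP Ppr] [idP' _] sPP' xiP xiP' Q0 QP.
have idlP := idealr_ideal idP; have idlP' := idealr_ideal idP'.
have [e [m0 m0Q m0e] emin] : exists2 e, exists2 m, m \in msupp Q & m i = e &
    forall m, m \in msupp Q -> (e <= m i)%N.
  have exm : exists e, has (fun m : 'X_{1..n} => m i == e) (msupp Q).
    exists (mlead Q i); apply/hasP; exists (mlead Q) => //.
    exact: mlead_supp.
  exists (ex_minn exm); case: ex_minnP => e /hasP[m mQ /eqP me] emin.
    by exists m.
  by move=> m' m'Q; apply: emin; apply/hasP; exists m'.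
pose sh (m : 'X_{1..n}) := (m - U_(i) *+ e)%MM.
have shK m : m \in msupp Q -> (U_(i) *+ e + sh m)%MM = m.
  move=> /emin em; rewrite addmC submK //; apply/mnm_lepP => j.
  by rewrite mulmnE mnm1E; case: eqP => [<-|_]; rewrite ?mul1n ?mul0n.
(* T is the value of Q divided by X_i^e; it lies in P because x_i does not and P is prime. *)
pose T := \sum_(m <- msupp Q) cst Q@_m * mmap1 x (sh m).
have TP : T \in P.
  have: x i ^+ e * T \in P.
    suff <- : mmap cst x Q = x i ^+ e * T by [].
    rewrite /mmap mulr_sumr big_seq [RHS]big_seq.
    apply: eq_bigr => m mQ; rewrite mulrCA; congr (_ * _).
    by rewrite -{1}(shK m mQ) mmap1D mmap1Mn mmap1U.
  elim: (e) => [|c IH]; first by rewrite mul1r.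
  by rewrite exprS -mulrA => /Ppr; rewrite (negPf xiP) => /IH.
pose Q' : {mpoly k[n]} := \sum_(m <- msupp Q | m i == e) Q@_m *: 'X_[sh m].
have sh_inj : {in msupp Q &, injective sh}.
  by move=> m m' mQ m'Q shE; rewrite -(shK m mQ) shE shK.
have Q'supp m : m \in msupp Q' -> exists m', [/\ m' \in msupp Q, m' i = e & m = sh m'].
  move=> mQ'; apply: contrapT => nom; move: mQ'.
  rewrite mcoeff_msupp raddf_sum big_seq_cond big1 ?eqxx // => m' /andP[m'Q /eqP m'e].
  rewrite /= mcoeffZ mcoeffX; case: eqP => [mm'|_]; last by rewrite mulr0.
  by case: nom; exists m'.
exists Q'; split=> [||m /Q'supp[m' [m'Q m'e ->]]].
- apply/negP => /eqP Q'0; have : Q'@_(sh m0) = 0 by rewrite Q'0 mcoeff0.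
  rewrite raddf_sum -big_filter (bigD1_seq m0) ?filter_uniq ?msupp_uniq ?mem_filter ?m0e ?eqxx //=.
  rewrite mcoeffZ mcoeffX eqxx mulr1.
  rewrite big_seq_cond big1 ?addr0 => [/eqP|m /andP[]]; first by rewrite mcoeff_eq0 m0Q.
  rewrite mem_filter => /andP[_ mQ] mm0.
  rewrite mcoeffZ mcoeffX; case: eqP => [/sh_inj mE|_]; last by rewrite mulr0.
  by rewrite mE ?eqxx in mm0.
- have -> : mmap cst x Q' = T - \sum_(m <- msupp Q | m i != e) cst Q@_m * mmap1 x (sh m).
    rewrite /T (bigID (fun m : 'X_{1..n} => m i == e)) /= addrK raddf_sum.
    by apply: eq_bigr => m _; rewrite /= mmapZ mmapX.
  apply: (idealB idlP'); first exact: sPP'.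
  rewrite big_seq_cond; apply: (ideal_sum _ idlP') => m /andP[mQ me].
  apply: (idealM _ idlP'); rewrite /mmap1 (bigD1 i) //= mulrC; apply: (idealM _ idlP').
  rewrite mnmBE mulmnE mnm1E eqxx mul1n.
  have : (0 < m i - e)%N by rewrite subn_gt0 ltn_neqAle eq_sym me emin.
  by case: (_ - _)%N => // c _; rewrite exprSr; apply: (idealM _ idlP').
- split; first by rewrite mnmBE mulmnE mnm1E eqxx mul1n m'e subnn.
  by exists m' => // j ji; rewrite mnmBE mulmnE mnm1E eq_sym (negPf ji) mul0n subn0.
Qed.

(** Choose x_i in [p i.+1] outside [p i]. The value 0 of a relation lies in [p 0]; eliminating one
    variable at each step up the chain would leave a nonzero constant in the proper ideal [p n]. *)
Lemma dependent_chain n (p : nat -> {pred R}) :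
    (forall i, (i <= n)%N -> prime_ideal (p i)) ->
    (forall i, (i < n)%N -> {subset p i <= p i.+1} /\ ~ {subset p i.+1 <= p i}) ->
  exists x : 'I_n -> R, forall Q : {mpoly k[n]}, mmap cst x Q = 0 -> Q = 0.
Proof.
move=> pprime pstrict.
have /all_sig[x Hx] : forall i : 'I_n, {x | x \in p i.+1 & x \notin p i}.
  move=> i; apply: cid2; apply: contrapT => nox.
  have [_ []] := pstrict i (ltn_ord i) => x xp; apply: contrapT => /negP xnp.
  by apply: nox; exists x.
exists x => Q Qx0; apply/eqP/negPn/negP => Q0.
have [T [T0 TP Tm]] : exists T : {mpoly k[n]}, [/\ T != 0, mmap cst x T \in p n &
    forall m, m \in msupp T -> forall j : 'I_n, (j < n)%N -> m j = 0%N].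
  suff step i : (i <= n)%N -> exists T : {mpoly k[n]}, [/\ T != 0, mmap cst x T \in p i &
      forall m, m \in msupp T -> forall j : 'I_n, (j < i)%N -> m j = 0%N].
    exact: step.
  elim: i => [|i IH] ilt.
    by exists Q; split=> //; rewrite Qx0; have [[]] := pprime 0%N ilt.
  have [T [T0 TP Tm]] := IH (ltnW ilt); pose o := Ordinal ilt.
  have [xp xnp] := Hx o.
  have [T' [T'0 T'P T'm]] := eliminate_variable (pprime i (ltnW ilt)) (pprime _ ilt)
    (pstrict i ilt).1 xnp xp T0 TP.
  exists T'; split=> // m /T'm[mi [m' m'T mm']] j.
  rewrite ltnS leq_eqVlt => /orP[/eqP ji|ji]; first by rewrite (_ : j = o) //; apply: val_inj.
  by rewrite mm' ?(Tm m') // -val_eqE /= ltn_eqF.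
have [idP _] := pprime n (leqnn n).
have TE : T = (T@_0)%:MP.
  apply/mpolyP => m; rewrite mcoeffC; have [->|m0] := eqVneq m 0%MM; first by rewrite mulr1.
  rewrite mulr0; apply: memN_msupp_eq0; apply: contra m0 => mT.
  by apply/eqP/mnmP => j; rewrite mnm0E (Tm m).
have: cst T@_0 \notin p n.
  by apply: rmorph_unit_notin => //; apply: contra T0 => /eqP T00; rewrite TE T00 mpolyC0.
by rewrite -(mmapC x cst) -TE TP.
Qed.

Variables (r : nat) (iota : {rmorphism R -> {mpoly k[r]}}).
Hypotheses (iota_inj : injective iota) (iota_cst : forall c, iota (cst c) = c%:MP).

Lemma iota_mmap n (x : 'I_n -> R) (Q : {mpoly k[n]}) :
  iota (mmap cst x Q) = mmap (@mpolyC r k) (fun i => iota (x i)) Q.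
Proof.
rewrite /mmap rmorph_sum; apply: eq_bigr => m _; rewrite rmorphM /= iota_cst.
by rewrite /mmap1 rmorph_prod; congr (_ * _); apply: eq_bigr => i _; rewrite rmorphXn.
Qed.

(** With all r variables placed in J the condition on s is vacuous, so every coefficient of the
    combination vanishes. *)
Lemma algebraic_dependence n (x : 'I_n -> R) : (r < n)%N ->
  exists2 Q : {mpoly k[n]}, Q != 0 & mmap cst x Q = 0.
Proof.
move=> rn; have [|Q [Q0 _ Qs]] :=
  @vanishing_combination k n r (fun i => iota (x i)) setT setT 0.
  by rewrite !cardsT !card_ord.
exists Q => //; apply: iota_inj; rewrite rmorph0 iota_mmap.
by apply/mpolyP => s; rewrite mcoeff0; apply: Qs => i; rewrite inE.
Qed.

Lemma prime_chain_length n (p : nat -> {pred R}) :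
    (forall i, (i <= n)%N -> prime_ideal (p i)) ->
    (forall i, (i < n)%N -> {subset p i <= p i.+1} /\ ~ {subset p i.+1 <= p i}) ->
  (n <= r)%N.
Proof.
move=> pprime pstrict; rewrite leqNgt; apply/negP => rn.
have [x xind] := dependent_chain pprime pstrict.
by have [Q /eqP Q0 /xind] := algebraic_dependence x rn.
Qed.

End KrullDimension.

(** * Zariski's lemma *)

Section ZariskiLemma.

(** A monomial is determined by its last exponent and the remaining ones, so no terms merge in
    [muni Q]. *)
Lemma muni_neq0 (k : nzRingType) n (Q : {mpoly k[n.+1]}) : Q != 0 -> muni Q != 0.
Proof.
apply: contra => /eqP Q0; apply/eqP/mpolyP => m0.
pose res (m : 'X_{1..n.+1}) := [multinom m (widen_ord (leqnSn n) i) | i < n].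
have m_eq m : res m = res m0 -> m ord_max = m0 ord_max -> m = m0.
  move=> /mnmP resE maxE; apply/mnmP => i.
  have [/eqP|im] := eqVneq (val i) n.
    by rewrite -[n]/(val (@ord_max n)) val_eqE => /eqP->.
  have ilt : (i < n)%N by rewrite ltn_neqAle im -ltnS ltn_ord.
  have /(_ (Ordinal ilt)) := resE; rewrite !mnmE.
  by rewrite (_ : widen_ord _ _ = i) //; apply: val_inj.
have : ((muni Q)`_(m0 ord_max))@_(res m0) = 0 by rewrite Q0 coef0 mcoeff0.
rewrite muniE coef_sum raddf_sum /= => H.
have [m0Q|/memN_msupp_eq0->] := boolP (m0 \in msupp Q); last by rewrite mcoeff0.
rewrite mcoeff0 -[RHS]H (bigD1_seq m0) ?msupp_uniq //= coefZ coefXn eqxx mulr1.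
rewrite mcoeffZ mcoeffX eqxx mulr1 big1 ?addr0 // => m mm0.
rewrite coefZ coefXn; case: eqP => [mE|_]; last by rewrite mulr0 mcoeff0.
rewrite mulr1 mcoeffZ mcoeffX; case: eqP => [resE|_]; last by rewrite mulr0.
by rewrite (m_eq m) ?eqxx // in mm0.
Qed.

Lemma horner_muni (k : fieldType) (K : comNzRingType) (f : {rmorphism k -> K}) n
    (x : 'I_n -> K) z (Q : {mpoly k[n.+1]}) :
  (map_poly (mmap f x) (muni Q)).[z] =
  mmap f (fun i => if unlift ord_max i is Some j then x j else z) Q.
Proof.
rewrite muniE rmorph_sum /= horner_sum; apply: eq_bigr => m _.
rewrite map_polyZ map_polyXn hornerZ hornerXn /= mmapZ mmapX -mulrA; congr (_ * _).
rewrite /mmap1 big_ord_recr /= unlift_none; congr (_ * _).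
apply: eq_bigr => i _; rewrite mnmE.
rewrite (_ : widen_ord _ _ = lift ord_max i) ?liftK //.
by apply: val_inj; rewrite /= /bump leqNgt ltn_ord.
Qed.

(** For q of degree e + 1 with leading coefficient a, multiplying q(z) = 0 by a^e gives a monic
    equation for a z. *)
Lemma integral_lead_coef (D K : comNzRingType) (f : {rmorphism D -> K}) (q : {poly D}) z :
  (1 < size q)%N -> (map_poly f q).[z] = 0 -> integralOver f (f (lead_coef q) * z).
Proof.
move=> q1 qz; set a := lead_coef q; pose e := (size q).-2.
have sq : size q = e.+2 by rewrite /e; case: (size q) q1 => [|[]].
pose r := \poly_(i < e.+1) (a ^+ (e - i) * q`_i).
exists ('X^(e.+1) + r).
  rewrite monicE lead_coefDl ?lead_coefXn // size_polyXn ltnS.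
  exact: size_poly.
apply/eqP; rewrite rmorphD /= map_polyXn hornerD hornerXn.
have qe : \sum_(i < e.+1) f q`_i * z ^+ i = - (f a * z ^+ e.+1).
  apply/eqP; rewrite -addr_eq0 -[X in _ == X]qz; apply/eqP.
  have sm : (size (map_poly f q) <= e.+2)%N by rewrite -sq; apply: size_poly.
  rewrite [RHS](horner_coef_wide _ sm) [RHS]big_ord_recr /= coef_map.
  by rewrite /a lead_coefE sq; congr (_ + _); apply: eq_bigr => i _; rewrite coef_map.
rewrite (horner_coef_wide (n := e.+1)); last first.
  by apply: leq_trans (size_poly _ _) _; apply: size_poly.
have -> : \sum_(i < e.+1) (map_poly f r)`_i * (f a * z) ^+ i =
    f a ^+ e * \sum_(i < e.+1) f q`_i * z ^+ i.
  rewrite mulr_sumr; apply: eq_bigr => i _.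
  have ie : (i <= e)%N by rewrite -ltnS.
  rewrite coef_map /r coef_poly ltn_ord /= rmorphM rmorphXn exprMn /=.
  have -> : f a ^+ e = f a ^+ (e - i) * f a ^+ i by rewrite -exprD subnK.
  by ring.
by rewrite qe exprMn !exprS; ring.
Qed.

Variables (k : fieldType) (K : comNzRingType) (f : {rmorphism k -> K}).
Hypothesis K_field : forall z : K, z != 0 -> exists c, c * z = 1.

Definition independent n (x : 'I_n -> K) :=
  forall Q : {mpoly k[n]}, mmap f x Q = 0 -> Q = 0.

(** Adjoining z to x creates a relation. Its degree in the last variable is positive, since x is
    independent, and its leading coefficient in that variable is the multiplier. *)
Lemma lead_coef_integral n (x : 'I_n -> K) z :
    independent x -> (forall y : 'I_n.+1 -> K, ~ independent y) ->
  exists2 a : {mpoly k[n]}, a != 0 & integralOver (mmap f x) (mmap f x a * z).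
Proof.
move=> xind /(_ (fun i => if unlift ord_max i is Some j then x j else z)).
move=> /existsNP[Q /not_implyP[Qz /eqP Q0]].
have q0 := muni_neq0 Q0; pose q := muni Q.
exists (lead_coef q); first by rewrite lead_coef_eq0.
apply: integral_lead_coef; last by rewrite horner_muni.
rewrite ltnNge; apply/negP => /size1_polyC qE.
have /xind q00 : mmap f x q`_0 = 0.
  by rewrite -Qz -horner_muni -/q [in RHS]qE map_polyC hornerC.
by rewrite -/q qE q00 polyC0 eqxx in q0.
Qed.

Lemma integral_scaled n (x : 'I_n -> K) l (g : 'I_l -> K) (a : {mpoly k[n]}) :
    (forall j, integralOver (mmap f x) (mmap f x a * g j)) ->
  forall Q : {mpoly k[l]}, exists N, integralOver (mmap f x) (mmap f x a ^+ N * mmap f g Q).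
Proof.
move=> gint Q; exists (msize Q).
have int_ev b : integralOver (mmap f x) (mmap f x b) by exact: integral_id.
rewrite /mmap -/(mmap f x a) mulr_sumr big_seq.
have int_exp u e : integralOver (mmap f x) u -> integralOver (mmap f x) (u ^+ e).
  move=> uint; elim: e => [|e IH]; first exact: integral1.
  by rewrite exprS; apply: integral_mul.
apply: (big_ind (integralOver (mmap f x))) => [||m mQ].
- exact: integral0.
- by move=> u v; apply: integral_add.
rewrite -(subnK (ltnW (msize_mdeg_lt mQ))) exprD mulrACA.
apply: integral_mul.
  by apply: integral_mul; [apply: int_exp | rewrite -(mmapC x f)].
rewrite mdegE expr_sum /mmap1 -big_split /=.
apply: (big_ind (integralOver (mmap f x))) => [||i _].
- exact: integral1.
- by move=> u v; apply: integral_mul.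
by rewrite -exprMn; apply: int_exp.
Qed.
(* b = 1 + X_0 a is prime to a; as K is integral over D[1/a], with D the
   polynomial ring, b would divide a power of a, hence be a unit. *)
Lemma zariski_lemma l (g : 'I_l -> K) N :
    (forall z, exists Q, z = mmap f g Q) ->
    (forall x : 'I_N -> K, ~ independent x) ->
  forall y : 'I_1 -> K, ~ independent y.
Proof.
move=> gen depN y yind.
(* n + 1 is the largest size of an independent family; y shows that it is positive. *)
have [n [x xind] nmax] : exists2 n, exists x : 'I_n.+1 -> K, independent x &
    forall x : 'I_n.+2 -> K, ~ independent x.
  apply: contrapT => nomax.
  have ind n : exists x : 'I_n.+1 -> K, independent x.
    elim: n => [|n IH]; first by exists y.
    by apply: contrapT => /forallNP H; apply: nomax; exists n.
  (* For N = 0 the empty family is independent, since nonzero constants are invertible in K. *)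
  case: N depN => [|N] depN; last by have [x] := ind N; apply: depN.
  have i0 (i : 'I_0) : K by case: i.
  apply: (depN i0) => Q; rewrite [Q]nvar0_mpolyC mmapC => /eqP; apply: contraTeq => Q0.
  have {}Q0 : Q@_0 != 0 by apply: contra Q0 => /eqP->; rewrite mpolyC0.
  by apply/eqP => H; have := oner_neq0 K; rewrite -(rmorph1 f) -(mulVf Q0) rmorphM /= H mulr0 eqxx.
pose ev : {rmorphism {mpoly k[n.+1]} -> K} := mmap f x.
have /all_sig[a Ha] : forall j, {a : {mpoly k[n.+1]} | a != 0 & integralOver ev (ev a * g j)}.
  by move=> j; apply: cid2; apply: lead_coef_integral.
pose A := \prod_j a j.
have A0 : A != 0 by apply/prodf_neq0 => j _; have [] := Ha j.
have Aint j : integralOver ev (ev A * g j).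
  have -> : ev A * g j = ev (\prod_(i | i != j) a i) * (ev (a j) * g j).
    by rewrite /A (bigD1 j) //= rmorphM /=; ring.
  by apply: integral_mul; [apply: integral_id | have [] := Ha j].
pose X : {mpoly k[n.+1]} := 'X_ord0.
pose b := 1 + X * A.
have XA0 : (X * A)@_0 = 0.
  rewrite mulrC; apply: memN_msupp_eq0; rewrite (perm_mem (msuppMX _ _)).
  apply/mapP => -[m _ /eqP].
  by rewrite eq_sym mnmD_eq0 mnm1_eq0.
have b0 : b != 0.
  apply/eqP => /(congr1 (mcoeff 0%MM)); rewrite mcoeffD mcoeff1 eqxx XA0 addr0 mcoeff0.
  by apply/eqP/oner_neq0.
have [c cb] : exists c, c * ev b = 1.
  by apply: K_field; apply: contra b0 => /eqP/xind->.
have [Q cQ] := gen c; have [e] := integral_scaled Aint Q.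
rewrite -cQ -rmorphXn => -[M Mmonic /eqP M0].
(* The integral equation of A^e c, multiplied by b^d where c b = 1, becomes a polynomial identity by
   independence, and it shows that b divides A^(e d). *)
have [u Au] : exists u, A ^+ (e * (size M).-1) = b * u.
  pose d := (size M).-1.
  have sM : size M = d.+1.
    by rewrite prednK // size_poly_gt0 monic_neq0.
  have : \sum_(i < d.+1) M`_i * A ^+ (e * i) * b ^+ (d - i) = 0.
    apply: xind; rewrite -/(ev _) rmorph_sum -[RHS](mulr0 (ev b ^+ d)) -[in RHS]M0.
    have sm : (size (map_poly ev M) <= d.+1)%N by rewrite -sM; apply: size_poly.
    rewrite (horner_coef_wide _ sm) mulr_sumr; apply: eq_bigr => i _.
    rewrite /= !rmorphM !rmorphXn /= coef_map exprMn -exprM.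
    have -> : ev b ^+ d = ev b ^+ (d - i) * ev b ^+ i by rewrite -exprD subnK // -ltnS.
    have cbi : c ^+ i * ev b ^+ i = 1 by rewrite -exprMn cb expr1n.
    rewrite /= -[LHS]mulr1 -cbi; ring.
  rewrite big_ord_recr /= subnn mulr1; have -> : M`_d = 1 by apply/monicP.
  rewrite mul1r addrC => /eqP; rewrite addr_eq0 => /eqP->.
  exists (- \sum_(i < d) M`_i * A ^+ (e * i) * b ^+ (d - i).-1).
  rewrite mulrN mulr_sumr; congr (- _); apply: eq_bigr => i _.
  by rewrite mulrCA -exprS prednK // subn_gt0.
(* Modulo b the product X A is -1, so its powers are units; a power of A divisible by b then makes b
   a unit. *)
have b1 m : exists t, (X * A) ^+ m = (-1) ^+ m + b * t.
  elim: m => [|m [t IH]]; first by exists 0; rewrite mulr0 addr0.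
  exists ((-1) ^+ m + X * A * t).
  rewrite exprS IH exprS; rewrite /b; ring.
have [t Ht] := b1 (e * (size M).-1)%N; set m := (e * _)%N in Au Ht.
have bu : b * ((-1) ^+ m * (X ^+ m * u - t)) = 1.
  rewrite mulrCA mulrBr mulrCA -Au -exprMn Ht addrK -exprD addnn -mul2n exprM.
  by rewrite sqrrN expr1n expr1n.
have X0 : X != 0 by rewrite -msupp_eq0 msuppX.
have v0 : (-1) ^+ m * (X ^+ m * u - t) != 0.
  by apply: contraTneq (oner_neq0 {mpoly k[n.+1]}) => v0; rewrite -bu v0 mulr0 eqxx.
have := msizeM b0 v0; rewrite bu msize1 => bs.
(* A unit is constant, and the constant term of b is 1, so b = 1 and X A = 0, which is
   impossible. *)
have b_size : (msize b <= 1)%N.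
  move: v0 bs; rewrite -msize_poly_eq0.
  by move: (msize b) (msize (_ * _)) => i j; lia.
have /eqP := msize1_polyC b_size; rewrite {2}/b mcoeffD mcoeff1 eqxx XA0 addr0 mpolyC1.
by rewrite /b -subr_eq0 addrC addKr mulf_eq0 (negPf X0) (negPf A0).
Qed.
End ZariskiLemma.

(** * Dickson's lemma and the Hilbert basis theorem *)

Section HilbertBasis.
Variable n : nat.

(** Induction on the number of coordinates that are not constant on V; J collects constant ones. An
    element not above a fixed m0 has some coordinate smaller than that of m0, hence at most
    [mdeg m0]; fixing this coordinate leaves finitely many smaller cases. *)
Lemma dickson (U : 'X_{1..n} -> Prop) :
  exists2 s : seq 'X_{1..n}, forall m, m \in s -> U m &
    forall m, U m -> exists2 m', m' \in s & (m' <= m)%MM.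
Proof.
suff H c (J : {set 'I_n}) (V : 'X_{1..n} -> Prop) : (#|~: J| <= c)%N ->
    (forall m m', V m -> V m' -> forall i, i \in J -> m i = m' i) ->
    exists2 s : seq 'X_{1..n}, forall m, m \in s -> V m &
      forall m, V m -> exists2 m', m' \in s & (m' <= m)%MM.
  apply: (H #|~: (set0 : {set 'I_n})| set0) => // m m' _ _ i.
  by rewrite inE.
elim: c J V => [|c IH] J V Jc VJ.
all: have [[m0 Vm0]|noV] := pselect (exists m, V m); last first.
- by exists [::] => // m Vm; case: noV; exists m.
- exists [:: m0] => [m|m Vm]; first by rewrite inE => /eqP->.
  exists m0; rewrite ?inE //; apply/mnm_lepP => i.
  rewrite (VJ m0 m) // -[_ \in J]negbK -in_setC.
  by move: Jc; rewrite leqn0 cards_eq0 => /eqP->; rewrite inE.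
- by exists [::] => // m Vm; case: noV; exists m.
have /all_sig2[s sV sdom] : forall ij : 'I_n * 'I_(mdeg m0).+1,
    {s : seq 'X_{1..n} | forall m, m \in s -> V m &
      ij.1 \notin J -> forall m, V m -> m ij.1 = ij.2 -> exists2 m', m' \in s & (m' <= m)%MM}.
  move=> [i j] /=; apply: cid2; have [iJ|iJ] := boolP (i \in J); first by exists [::].
  have [|m m' [Vm mi] [Vm' m'i] l|s sV sdom] :=
      IH (i |: J) (fun m => V m /\ m i = j).
  - rewrite setCU -setDE -ltnS; apply: leq_trans Jc.
    rewrite (cardsD1 i (~: J)) inE iJ /= setDE.
    by rewrite add1n ltnS setDE setIC.
  - by rewrite !inE => /orP[/eqP->|/(VJ m m' Vm Vm')//]; rewrite mi m'i.
  - by exists s => [m /sV[]//|_ m Vm mi]; apply: sdom.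
exists (m0 :: flatten [seq s ij | ij : 'I_n * 'I_(mdeg m0).+1]) => [m|m Vm].
  by rewrite inE => /orP[/eqP->//|/flattenP[_ /mapP[ij _ ->] /sV]].
have [m0m|] := boolP (m0 <= m)%MM; first by exists m0; rewrite ?mem_head.
move=> /mnm_lepP/existsNP[i /negP]; rewrite -ltnNge => mi.
have mi' : (m i < (mdeg m0).+1)%N.
  by rewrite ltnS; apply: leq_trans (ltnW mi) _; apply: mdeg_ge_coord.
have iJ : i \notin J by apply/negP => /(VJ m m0 Vm Vm0) E; rewrite E ltnn in mi.
have [m' m's m'm] := sdom (i, Ordinal mi') iJ m Vm erefl.
exists m' => //; rewrite inE; apply/orP; right.
by apply/flattenP; exists (s (i, Ordinal mi')) => //; apply/mapP; exists (i, Ordinal mi'); rewrite ?mem_enum.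
Qed.

Variable k : fieldType.

(** Dickson's lemma selects finitely many elements whose leading monomials divide those of all the
    others; division by them lowers the leading monomial until nothing remains. *)
Lemma mpoly_ideal_fg (I : {mpoly k[n]} -> Prop) : ideal I ->
  exists2 xs : seq {mpoly k[n]}, forall x, x \in xs -> I x &
    forall f, I f -> ideal_generated (fun x => x \in xs) f.
Proof.
move=> idI.
have [s sU sdom] := dickson (fun m => exists f, [/\ I f, f != 0 & mlead f = m]).
have [xs xsI xsdom] : exists2 xs : seq {mpoly k[n]}, forall x, x \in xs -> I x &
    forall f, I f -> f != 0 -> exists x, [/\ x \in xs, x != 0 & (mlead x <= mlead f)%MM].
  have [xs xsI xss] : exists2 xs : seq {mpoly k[n]}, forall x, x \in xs -> I x &
      forall m, m \in s -> exists x, [/\ x \in xs, x != 0 & mlead x = m].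
    elim: s sU {sdom} => [|m s IH] sU; first by exists [::].
    have [m' m's|xs xsI xss] := IH; first by apply: sU; rewrite inE m's orbT.
    have [x [Ix x0 xm]] := sU m (mem_head _ _); exists (x :: xs) => [y|m'].
      by rewrite inE => /orP[/eqP->|/xsI].
    rewrite inE => /orP[/eqP->|/xss[y [yxs y0 ym]]].
      by exists x; rewrite mem_head.
    by exists y; rewrite inE yxs orbT.
  exists xs => // f If f0; have [|m /xss[x [xxs x0 <-]] xf] := sdom (mlead f).
    by exists f.
  by exists x.
exists xs => // f; have idX := ideal_generated_ideal (fun x => x \in xs).
move: {-1}(mlead f) (erefl (mlead f)) => m; move: m f.
apply: ltmwf => m IH f fm If.
have [->|f0] := eqVneq f 0; first by case: idX.
have [x [xxs x0 xf]] := xsdom f If f0.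
pose u := (mleadc f / mleadc x) *: 'X_[mlead f - mlead x].
have xu : mlead (u * x) = mlead f /\ mleadc (u * x) = mleadc f.
  have lx : mleadc x != 0 by rewrite mleadc_eq0.
  have u0 : mleadc f / mleadc x != 0 by rewrite mulf_neq0 ?invr_eq0 ?mleadc_eq0.
  have lu : mlead u = (mlead f - mlead x)%MM by rewrite /u mleadZ // mleadXm.
  have un0 : u != 0 by rewrite /u -mleadc_eq0 lu mcoeffZ mcoeffX eqxx mulr1.
  have lux : mlead (u * x) = mlead f by rewrite mleadM // lu submK.
  split=> //; rewrite lux -{1}lux mleadM // mleadcM lu mcoeffZ mcoeffX eqxx mulr1.
  by rewrite divfK.
rewrite -[f](subrK (u * x)); apply: (idealD idX); last first.
  by apply: (idealM _ idX); apply: sub_ideal_generated.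
have [->|g0] := eqVneq (f - u * x) 0; first by case: idX.
apply: (IH (mlead (f - u * x))) => //; last first.
  by apply: idealB => //; apply: idealM => //; apply: xsI.
rewrite -fm lt_neqAle; apply/andP; split.
  apply/eqP => E; move: g0; rewrite -mleadc_eq0 E mcoeffB -{2}xu.1 xu.2.
  by rewrite subrr eqxx.
by have := mleadB_le f (u * x); rewrite xu.1 joinxx.
Qed.

Lemma noetherian_quotient (R : comNzRingType) (h : {rmorphism {mpoly k[n]} -> R}) :
  (forall z, exists Q, z = h Q) -> noetherian R.
Proof.
move=> hsurj I idI; have idI' := idealr_ideal idI.
have [|xs xsI xsgen] := @mpoly_ideal_fg (fun f => h f \in I).
  split; first by rewrite rmorph0; case: idI'.
  by move=> a x y Ix Iy; rewrite rmorphD rmorphM; case: idI' => _; apply.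
exists (map h xs) => f; split=> [|]; last first.
  apply: (ideal_generated_min (J := fun x => x \in I)) => // y /mapP[x xxs ->].
  exact: xsI.
have [Q ->] := hsurj f => /xsgen; have idX := ideal_generated_ideal (fun x => x \in map h xs).
apply: (ideal_generated_min (J := fun Q => ideal_generated (fun x => x \in map h xs) (h Q))).
  split; first by rewrite rmorph0; case: idX.
  by move=> a x y Ix Iy; rewrite rmorphD rmorphM; case: idX => _; apply.
by move=> x xxs; apply: sub_ideal_generated; apply: map_f.
Qed.

End HilbertBasis.

(** * Univariate polynomials in distinct variables *)

Section UnivariateRegularSequence.
Variables (k : fieldType) (n r : nat) (f : nat -> {poly k}) (y : nat -> 'I_n).
Hypotheses (f_neq0 : forall i, (i < r)%N -> f i != 0)
  (y_inj : forall i j, (i < r)%N -> (j < r)%N -> y i = y j -> i = j).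
Implicit Types (p q : {mpoly k[n]}) (m : 'X_{1..n}).

Definition mpoly_of_poly i : {mpoly k[n]} :=
  \sum_(e < size (f i)) (f i)`_e *: 'X_[U_(y i) *+ e].

Local Notation F := mpoly_of_poly.
Local Notation J i := (power_ideal F i (fun=> 1%N)).
Local Notation deg i := (size (f i)).-1.

(** The remainders of division by the first i polynomials, each in its own variable; they form a
    complement of the ideal [J i]. *)
Definition reduced i p : Prop :=
  forall m, m \in msupp p -> forall j, (j < i)%N -> (m (y j) < deg j)%N.

Lemma reduced0 i : reduced i 0.
Proof. by move=> m; rewrite msupp0. Qed.

Lemma reducedD i p q : reduced i p -> reduced i q -> reduced i (p + q).
Proof.
by move=> rp rq m /msuppD_le; rewrite mem_cat => /orP[/rp|/rq].
Qed.

Lemma reducedZ i c p : reduced i p -> reduced i (c *: p).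
Proof. by move=> rp m /msuppZ_le/rp. Qed.

Lemma reducedX i m :
  (forall j, (j < i)%N -> (m (y j) < deg j)%N) -> reduced i 'X_[m].
Proof. by move=> mi m'; rewrite msuppX inE => /eqP->. Qed.

Lemma reducedW i p : reduced i.+1 p -> reduced i p.
Proof. by move=> rp m mp j ji; apply: rp => //; apply: ltnW. Qed.

Lemma reduced_mulF i p : (i < r)%N -> reduced i p -> reduced i (F i * p).
Proof.
move=> ir rp m /msuppM_le/allpairsP[[m1 m2] /= [m1F m2p ->]] j ji.
have [e ->] : exists e, m1 = (U_(y i) *+ e)%MM.
  apply: contrapT => noe; move: m1F; rewrite mcoeff_msupp raddf_sum big1 ?eqxx // => e _.
  rewrite /= mcoeffZ mcoeffX; case: eqP => [m1E|_]; last by rewrite mulr0.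
  by case: noe; exists e.
rewrite mnmDE mulmnE mnm1E; case: eqP => [/y_inj yij|_]; last exact: rp.
by have := ji; rewrite (yij ir (ltn_trans ji ir)) ltnn.
Qed.

(** Univariate division in the variable [y i]: the leading term of [f i] is traded for lower powers,
    by induction on the exponent of that variable. *)
Lemma division_monomial i m : (i < r)%N ->
    (forall j, (j < i)%N -> (m (y j) < deg j)%N) ->
  exists q, reduced i.+1 ('X_[m] - F i * q).
Proof.
move=> ir; have [N] := ubnP (m (y i)); elim: N m => // N IH m mN mi.
have [md|md] := ltnP (m (y i)) (deg i).
  exists 0; rewrite mulr0 subr0; apply: reducedX => j.
  by rewrite ltnS leq_eqVlt => /orP[/eqP->|/mi].
have lc0 : lead_coef (f i) != 0 by rewrite lead_coef_eq0 f_neq0.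
have sf : size (f i) = (deg i).+1 by rewrite prednK // size_poly_gt0 f_neq0.
pose m' := (m - U_(y i) *+ deg i)%MM.
have m'E : (U_(y i) *+ deg i + m')%MM = m.
  rewrite addmC submK //; apply/mnm_lepP => j.
  by rewrite mulmnE mnm1E; case: eqP => [<-|_]; rewrite ?mul1n ?mul0n.
have lower (e : 'I_(deg i)) : exists q, reduced i.+1 ('X_[U_(y i) *+ e + m'] - F i * q).
  have mm' j : (U_(y i) *+ e + m')%MM j = (if j == y i then m j - (deg i - e) else m j)%N.
    rewrite -m'E !mnmDE !mulmnE mnm1E [y i == j]eq_sym; case: eqP => _; last by rewrite !mul0n.
    by rewrite !mul1n; have := ltn_ord e; lia.
  apply: IH => [|j ji]; rewrite mm'.
    by rewrite eqxx; have := ltn_ord e; lia.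
  case: eqP => _; last exact: mi.
  by apply: leq_ltn_trans (mi j ji); apply: leq_subr.
have /all_sig[q Hq] : forall e : 'I_(deg i), {q | reduced i.+1 ('X_[U_(y i) *+ e + m'] - F i * q)}.
  by move=> e; apply: cid.
exists ((lead_coef (f i))^-1 *: ('X_[m'] - \sum_(e < deg i) (f i)`_e *: q e)).
have -> : 'X_[m] - F i * ((lead_coef (f i))^-1 *: ('X_[m'] - \sum_(e < deg i) (f i)`_e *: q e)) =
    - (lead_coef (f i))^-1 *: \sum_(e < deg i) (f i)`_e *: ('X_[U_(y i) *+ e + m'] - F i * q e).
  have FX : F i * 'X_[m'] =
      \sum_(e < deg i) (f i)`_e *: 'X_[U_(y i) *+ e + m'] + lead_coef (f i) *: 'X_[m].
    rewrite mulr_suml sf big_ord_recr /= -lead_coefE -scalerAl -mpolyXD m'E.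
    by congr (_ + _); apply: eq_bigr => e _; rewrite -scalerAl -mpolyXD.
  have FS : F i * (\sum_(e < deg i) (f i)`_e *: q e) = \sum_(e < deg i) (f i)`_e *: (F i * q e).
    by rewrite mulr_sumr; apply: eq_bigr => e _; rewrite scalerAr.
  under [in RHS]eq_bigr do rewrite scalerBr.
  rewrite sumrB -scalerAr mulrBr FX FS.
  rewrite scaleNr -scalerN opprB scalerBr scalerBr scalerDr scalerA mulVf // scale1r.
  by rewrite addrAC opprD opprB addrCA subrr addr0.
apply: reducedZ; apply: (big_ind (reduced i.+1)) => [||e _].
- exact: reduced0.
- by move=> *; apply: reducedD.
- exact: reducedZ.
Qed.

Lemma division i p : (i < r)%N -> reduced i p ->
  exists q, reduced i.+1 (p - F i * q).
Proof.
move=> ir rp; rewrite [p]mpolyE big_seq.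
apply: (big_ind (fun p => exists q, reduced i.+1 (p - F i * q))) => [||m mp].
- by exists 0; rewrite mulr0 subrr; apply: reduced0.
- move=> u v [q rq] [q' rq']; exists (q + q').
  by rewrite mulrDr opprD addrACA; apply: reducedD.
- have [q rq] := division_monomial ir (rp m mp); exists (p@_m *: q).
  by rewrite -scalerAr -scalerBr; apply: reducedZ.
Qed.

Lemma reduced_form i p : (i <= r)%N -> exists2 q, J i q & reduced i (p - q).
Proof.
elim: i => [|i IH] ir; first by exists 0 => //; have [] := power_ideal_ideal F 0 (fun=> 1%N).
have [q Jq rq] := IH (ltnW ir); have [q' rq'] := division ir rq.
exists (q + F i * q'); last by rewrite opprD addrA.
by apply/power_idealS; exists q'; rewrite expr1 mulrC addrK.
Qed.

(** A monomial of p with the largest exponent in [y i], times the leading term of [F i], cannot be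
    cancelled. *)
Lemma leading_mulF i p : (i < r)%N -> p != 0 ->
  exists2 m, m \in msupp (F i * p) & (deg i <= m (y i))%N.
Proof.
move=> ir p0.
have sf : size (f i) = (deg i).+1 by rewrite prednK // size_poly_gt0 f_neq0.
have [m mp mmax] : exists2 m, m \in msupp p & forall m', m' \in msupp p -> (m' (y i) <= m (y i))%N.
  have exm : exists e, has (fun m => m (y i) == e) (msupp p).
    by exists (mlead p (y i)); apply/hasP; exists (mlead p) => //; apply: mlead_supp.
  have bnd e : has (fun m => m (y i) == e) (msupp p) -> (e <= msize p)%N.
    move=> /hasP[m mp /eqP <-]; apply: leq_trans (mdeg_ge_coord m (y i)) _.
    exact/ltnW/msize_mdeg_lt.
  case: (ex_maxnP exm bnd) => e /hasP[m mp /eqP me] emax; exists m => // m' m'p.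
  by rewrite me; apply: emax; apply/hasP; exists m'.
exists (U_(y i) *+ deg i + m)%MM; last by rewrite mnmDE mulmnE mnm1E eqxx mul1n leq_addr.
rewrite mcoeff_msupp mulr_suml raddf_sum sf big_ord_recr /= big1 ?add0r => [|e _].
  rewrite -scalerAl mcoeffZ [_ * p]mulrC mcoeffMX mulf_neq0 -?mcoeff_msupp //.
  by rewrite -lead_coefE lead_coef_eq0 f_neq0.
rewrite -scalerAl mcoeffZ [_ * p]mulrC.
have -> : (U_(y i) *+ deg i + m = U_(y i) *+ e + (U_(y i) *+ (deg i - e) + m))%MM.
  apply/mnmP => j; rewrite !mnmDE !mulmnE addnA -mulnDr subnKC //.
  exact/ltnW/ltn_ord.
rewrite mcoeffMX memN_msupp_eq0 ?mulr0 //; apply/negP => /mmax.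
rewrite mnmDE mulmnE mnm1E eqxx mul1n -[X in (_ <= X)%N]add0n leq_add2r.
by rewrite leqn0 subn_eq0 leqNgt ltn_ord.
Qed.

(** Reducing the cofactor c of [F i] makes p equal to [F i * (c - q)], by induction. If this is
    nonzero, its exponent in [y i] reaches the degree of [f i], contrary to p being reduced. *)
Lemma reduced_ideal_eq0 i p : (i <= r)%N -> J i p -> reduced i p -> p = 0.
Proof.
elim: i p => [|i IH] p ir; first by move=> [e ->]; rewrite big_ord0.
move=> /power_idealS[c]; rewrite expr1 => Jpc rp.
have idJ := power_ideal_ideal F i (fun=> 1%N).
have [q Jq rq] := reduced_form c (ltnW ir).
have pE : p = F i * (c - q).
  apply/eqP; rewrite -subr_eq0; apply/eqP; apply: IH; first exact: ltnW.
    have -> : p - F i * (c - q) = (p - c * F i) + F i * q by ring.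
    by apply: idealD => //; apply: idealM.
  apply: reducedD; first exact: reducedW.
  by rewrite -scaleN1r; apply: reducedZ; apply: reduced_mulF.
have [cq|/(leading_mulF ir)[m]] := eqVneq (c - q) 0; first by rewrite pE cq mulr0.
by rewrite -pE => /rp/(_ i (ltnSn i)); rewrite ltnNge => /negPf->.
Qed.

(** Once p is replaced by its remainder, [F i] times it is both reduced and in [J i], hence zero,
    and so is the remainder. *)
Lemma mpoly_of_poly_regular i p : (i < r)%N -> J i (F i * p) -> J i p.
Proof.
move=> ir JFp; have idJ := power_ideal_ideal F i (fun=> 1%N).
have [q Jq rq] := reduced_form p (ltnW ir).
have Fpq : F i * (p - q) = 0.
  apply: reduced_ideal_eq0 (ltnW ir) _ (reduced_mulF ir rq).
  by rewrite mulrBr; apply: idealB => //; apply: idealM.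
have [pq|/(leading_mulF ir)[m]] := eqVneq (p - q) 0; last by rewrite Fpq msupp0.
by rewrite (_ : p = q) //; apply/eqP; rewrite -subr_eq0 pq.
Qed.

End UnivariateRegularSequence.

(** * Lowest monomials *)

Section InitialMonomials.
Variables (n : nat) (R : comNzRingType).
Implicit Types (p q : {mpoly R[n]}) (m g d : 'X_{1..n}).

(** The order is the total monomial order that refines the degree. As a mere lower bound, g need not
    occur in p. *)
Definition supp_ge g p := forall m, m \in msupp p -> (g <= m)%O.
Definition supp_gt g p := forall m, m \in msupp p -> (g < m)%O.

Lemma supp_geD g p q : supp_ge g p -> supp_ge g q -> supp_ge g (p + q).
Proof. by move=> gp gq m /msuppD_le; rewrite mem_cat => /orP[/gp|/gq]. Qed.

Lemma supp_geN g p : supp_ge g p -> supp_ge g (- p).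
Proof. by move=> gp m; rewrite (perm_mem (msuppN _)) => /gp. Qed.

Lemma supp_geM g d p q : supp_ge g p -> supp_ge d q -> supp_ge (g + d)%MM (p * q).
Proof.
move=> gp dq m /msuppM_le/allpairsP[[m1 m2] /= [/gp m1p /dq m2q ->]].
exact: lem_add.
Qed.

Lemma supp_geX g m : (g <= m)%O -> supp_ge g ('X_[m] : {mpoly R[n]}).
Proof. by move=> gm m'; rewrite msuppX inE => /eqP->. Qed.

Lemma supp_geZ g c p : supp_ge g p -> supp_ge g (c *: p).
Proof. by move=> gp m /msuppZ_le/gp. Qed.

Lemma supp_gtW g p : supp_ge g p -> p@_g = 0 -> supp_gt g p.
Proof.
move=> gp pg0 m mp; rewrite lt_neqAle gp // andbT.
by apply: contraTneq mp => <-; rewrite -mcoeff_eq0 pg0.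
Qed.

Lemma supp_gt_coeff0 g p m : supp_ge g p -> (m < g)%O -> p@_m = 0.
Proof.
move=> gp mg; apply: memN_msupp_eq0; apply/negP => /gp.
by rewrite leNgt mg.
Qed.

(** Only g and d themselves can add up to g + d. The identity holds in the presence of zero
    divisors, where the lowest monomial of a product may disappear. *)
Lemma mcoeffM_lowest g d p q : supp_ge g p -> supp_ge d q ->
  (p * q)@_(g + d) = p@_g * q@_d.
Proof.
move=> gp dq; pose p' := p - p@_g *: 'X_[g].
have p'0 : p'@_g = 0 by rewrite mcoeffB mcoeffZ mcoeffX eqxx mulr1 subrr.
have gp' : supp_gt g p'.
  apply: supp_gtW p'0; apply: supp_geD => //; apply/supp_geN/supp_geZ.
  exact: supp_geX.
rewrite -[p](subrK (p@_g *: 'X_[g])) -/p' mulrDl mcoeffD.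
rewrite memN_msupp_eq0 ?add0r.
  by rewrite -scalerAl mcoeffZ mulrC [_ * q]mulrC mcoeffMX mcoeffD p'0 add0r mcoeffZ mcoeffX eqxx mulr1 mulrC.
apply/negP => /msuppM_le/allpairsP[[m1 m2] /= [/gp' m1p /dq m2q mE]].
by have := ltmc_le_add m1p m2q; rewrite -mE ltxx.
Qed.

Lemma mlast_ge p : supp_ge (mlast p) p.
Proof. by move=> m; apply: mlast_lemc. Qed.

(** Each step raises the lowest monomial, and only finitely many monomials have degree below D. *)
Lemma climb (V : {mpoly R[n]} -> Prop) D :
    (exists p, V p) ->
    (forall g p, (mdeg g < D)%N -> V p -> supp_ge g p -> exists2 q, V q & supp_gt g q) ->
  exists2 p, V p & forall m, m \in msupp p -> (D <= mdeg m)%N.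
Proof.
move=> [p Vp] step.
have [c] := ubnP #|[pred x : 'X_{1..n < D} | (mlast p <= x)%O]|.
elim: c p Vp => // c IH p Vp pc.
have [|low] := pselect (forall m, m \in msupp p -> (D <= mdeg m)%N); first by exists p.
have [m mp mD] : exists2 m, m \in msupp p & (mdeg m < D)%N.
  apply: contrapT => nom; apply: low => m mp; rewrite leqNgt; apply/negP => mD.
  by apply: nom; exists m.
have gD : (mdeg (mlast p) < D)%N.
  exact: leq_ltn_trans (lemc_mdeg (mlast_lemc mp)) mD.
have [q Vq gq] := step _ _ gD Vp (@mlast_ge p).
have [q0|q0] := eqVneq q 0; first by exists q; rewrite // q0 msupp0.
apply: (IH q) => //; rewrite -ltnS; apply: leq_trans pc; rewrite ltnS.
have pq := gq _ (mlast_supp q0).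
apply: proper_card; apply/properP; split.
  by apply/subsetP => x; rewrite !inE => /(lt_le_trans pq)/ltW.
exists (BMultinom gD); rewrite !inE /= ?lexx //.
by rewrite -ltNge.
Qed.

End InitialMonomials.

(** * Representations of ring elements by polynomials in a quasi-regular sequence *)

Section QuasiRegular.
Variables (r : nat) (R : comNzRingType) (f : nat -> R).
Hypothesis f_col : colon_powers f r.

Local Notation J := (power_ideal f r (fun=> 1%N)).
Local Notation eval p := (p.@[fun i : 'I_r => f i]).

Lemma lowest_coeff_ideal (p : {mpoly R[r]}) g :
  eval p = 0 -> supp_ge g p -> J p@_g.
Proof.
move=> p0 gp; apply: minimal_coeff_power_ideal => // m /gp gm mg.
by apply: contra mg => /lem_leo mg; rewrite eq_le mg gm.
Qed.

(** Writing the lowest coefficient as a combination of the f_j and moving each f_j into the monomial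
    raises its degree without changing the value. *)
Lemma absorb_lowest (p : {mpoly R[r]}) g : supp_ge g p -> J p@_g ->
  exists2 q : {mpoly R[r]}, eval q = eval p & supp_gt g q.
Proof.
move=> gp [e pE]; pose q := \sum_(j < r) e j *: ('X_[g + U_(j)] : {mpoly R[r]}).
have q_gt m : m \in msupp q -> (g < m)%O.
  move=> mq; apply: contraTT mq; rewrite -mcoeff_eq0 => mg.
  rewrite raddf_sum big1 // => j _; rewrite /= mcoeffZ mcoeffX.
  case: eqP => [mE|_]; last by rewrite mulr0.
  case/negP: mg; rewrite -mE lt_mdeg_ltmc //.
  by rewrite mdegD mdeg1 addn1.
exists (p - p@_g *: 'X_[g] + q).
  have qE : eval q = p@_g * eval 'X_[g].
    rewrite /q raddf_sum pE mulr_suml; apply: eq_bigr => j _ /=.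
    by rewrite mevalZ mpolyXD mevalM mevalXU expr1 -mulrA [f j * _]mulrC.
  by rewrite mevalD mevalB mevalZ qE subrK.
move=> m /msuppD_le; rewrite mem_cat => /orP[|/q_gt //].
apply: supp_gtW => [m' m'p|]; last by rewrite mcoeffB mcoeffZ mcoeffX eqxx mulr1 subrr.
move: m' m'p; apply: supp_geD => //; apply/supp_geN/supp_geZ.
exact: supp_geX.
Qed.

(** Starting from the constant h, lowest terms are absorbed until degree D is reached or a lowest
    coefficient falls outside J. *)
Lemma initial_form (h : R) D :
  (exists2 q : {mpoly R[r]}, eval q = h & forall m, m \in msupp q -> (D <= mdeg m)%N) \/
  (exists (q : {mpoly R[r]}) d, [/\ eval q = h, supp_ge d q & ~ J q@_d]).
Proof.
have [init|noinit] := pselect (exists (q : {mpoly R[r]}) d, [/\ eval q = h, supp_ge d q & ~ J q@_d]).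
  by right.
left; apply: (climb (V := fun q => eval q = h)) => [|g p _ ph gp].
  by exists h%:MP; rewrite mevalC.
have [Jp|nJp] := pselect (J p@_g); last by case: noinit; exists p, g.
by have [q qp gq] := absorb_lowest gp Jp; exists q; rewrite // qp.
Qed.

End QuasiRegular.

(** * A consequence of depth for subrings spanned by monomials *)

Section DepthCriterion.
Variables (k : fieldType) (r : nat) (R : comNzRingType).
Variables (cst : {rmorphism k -> R}) (iota : {rmorphism R -> {mpoly k[r]}}).
Hypotheses (iota_inj : injective iota) (iota_cst : forall c, iota (cst c) = c%:MP).
Variable f : nat -> R.
Hypotheses (f_col : colon_powers f r)
  (f_max : forall i, (i < r)%N -> (iota (f i))@_0 = 0).

Local Notation J := (power_ideal f r (fun=> 1%N)).
Local Notation fv := (fun i : 'I_r => f i).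
Local Notation eval p := (p.@[fv]).
Local Notation ev Q := (mmap cst fv Q).
Local Notation lift Q := (map_mpoly cst Q).

Lemma eval_lift (Q : {mpoly k[r]}) : eval (lift Q) = ev Q.
Proof.
have -> : lift Q = \sum_(m <- msupp Q) cst Q@_m *: 'X_[m].
  rewrite [X in lift X]mpolyE raddf_sum; apply: eq_bigr => m _ /=.
  by rewrite map_mpolyZ map_mpolyX.
by rewrite raddf_sum; apply: eq_bigr => m _ /=; rewrite mevalZ mevalX.
Qed.

Lemma power_ideal_const c x : c != 0 -> J (cst c * x) -> J x.
Proof.
move=> c0 /(idealM (cst c^-1) (power_ideal_ideal _ _ _)).
by rewrite mulrA -rmorphM mulVf // rmorph1 mul1r.
Qed.

Lemma power_ideal_const_notin c : c != 0 -> ~ J (cst c).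
Proof.
move=> c0; rewrite -[cst c]mulr1 => /(power_ideal_const c0)[e E].
have /(congr1 (mcoeff 0%MM)) := congr1 iota E.
rewrite rmorph1 mcoeff1 eqxx rmorph_sum raddf_sum big1 => [/eqP|i _]; first by rewrite oner_eq0.
by rewrite rmorphM expr1 /= rmorphM /= f_max ?mulr0.
Qed.

Lemma lift_supp_ge (Q : {mpoly k[r]}) : supp_ge (mlast Q) (lift Q).
Proof.
move=> m; rewrite mcoeff_msupp mcoeff_map_mpoly => H; apply: mlast_lemc.
by rewrite mcoeff_msupp; apply: contra H => /eqP->; rewrite raddf0.
Qed.

Lemma mlast_coeff_neq0 n (K : nzRingType) (Q : {mpoly K[n]}) : Q != 0 -> Q@_(mlast Q) != 0.
Proof. by move/mlast_supp; rewrite mcoeff_msupp. Qed.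

(** The f_i are algebraically independent over k: the lowest coefficient of a relation would be a
    nonzero constant in J. *)
Lemma ev_neq0 (Q : {mpoly k[r]}) : Q != 0 -> ev Q != 0.
Proof.
move=> Q0; apply/eqP => evQ0; move: (evQ0); rewrite -eval_lift => /(lowest_coeff_ideal f_col).
move=> /(_ _ (@lift_supp_ge Q)); rewrite mcoeff_map_mpoly.
exact/power_ideal_const_notin/mlast_coeff_neq0.
Qed.

Lemma mdeg_monomial_lower (m : 'X_{1..r}) s :
  s \in msupp (iota (\prod_(i < r) f i ^+ m i)) -> (mdeg m <= mdeg s)%N.
Proof.
have mulL (a b : nat) (p q : {mpoly k[r]}) : (forall s, s \in msupp p -> (a <= mdeg s)%N) ->
    (forall s, s \in msupp q -> (b <= mdeg s)%N) ->
    forall s, s \in msupp (p * q) -> (a + b <= mdeg s)%N.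
  move=> pa qb t /msuppM_le/allpairsP[[t1 t2] /= [/pa t1p /qb t2q ->]].
  by rewrite mdegD leq_add.
move: s; rewrite mdegE rmorph_prod.
apply: (big_rec2 (fun x n => forall s, s \in msupp x -> (n <= mdeg s)%N)) => [s|i n x _ IH] //.
apply: (mulL) => //; rewrite rmorphXn /=; elim: (m i) => [|c IHc] s //.
rewrite exprS -add1n; move: s; apply: (mulL) IHc => s; rewrite mcoeff_msupp lt0n mdeg_eq0.
by apply: contra => /eqP->; rewrite f_max.
Qed.

(* For each t, Q_t h_0 = Q_0 h_t with Q_t free of T_t: comparing lowest
   monomials, that of Q_0 divides that of h_0, and h_0 can be reduced modulo
   Q_0 to arbitrarily high order. *)
Lemma division_to_order (Q : 'I_r -> {mpoly k[r]}) (t0 : 'I_r) (z : 'I_r -> R) D :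
    (forall t, Q t != 0) -> (forall t m, m \in msupp (Q t) -> m t = 0%N) ->
    (forall t, ev (Q t) * z t0 = ev (Q t0) * z t) ->
  exists2 p : {mpoly R[r]}, exists w, eval p = z t0 - ev (Q t0) * w &
    forall m, m \in msupp p -> (D <= mdeg m)%N.
Proof.
move=> Q0 Qt Qz; have idJ := power_ideal_ideal f r (fun=> 1%N).
apply: climb => [|g p _ [w pw] gp].
  by exists (z t0)%:MP, 0; rewrite mevalC mulr0 subr0.
have [Jg|nJg] := pselect (J p@_g).
  have [q qp gq] := absorb_lowest gp Jg.
  by exists q => //; exists w; rewrite qp.
pose a t := mlast (Q t); pose c t := (Q t)@_(a t).
have c0 t : c t != 0 by apply: mlast_coeff_neq0.
(* If the lowest monomial of [Q t0] divides g, a multiple of [Q t0] cancels the term at g, and w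
   changes accordingly. *)
have [ag|] := boolP (a t0 <= g)%MM.
  pose u := cst (c t0)^-1 * p@_g.
  pose v : {mpoly R[r]} := u *: 'X_[g - a t0].
  exists (p - v * lift (Q t0)).
    exists (w + eval v); rewrite mevalB mevalM pw eval_lift.
    by rewrite mulrDr opprD addrA [eval v * _]mulrC.
  have agE : ((g - a t0) + a t0)%MM = g by rewrite submK.
  have gv : supp_ge g (v * lift (Q t0)).
    rewrite -{1}agE; apply: supp_geM; last exact: lift_supp_ge.
    exact/supp_geZ/supp_geX.
  apply: supp_gtW; first by apply: supp_geD => //; apply: supp_geN.
  rewrite mcoeffB -{2}agE (mcoeffM_lowest (g := (g - a t0)%MM)); last exact: lift_supp_ge.
    rewrite mcoeffZ mcoeffX eqxx mulr1 mcoeff_map_mpoly /u mulrAC -rmorphM mulVf //.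
    by rewrite rmorph1 mul1r subrr.
  exact/supp_geZ/supp_geX.
(* Otherwise some variable t has a smaller exponent in g than in the lowest monomial of [Q t0]; the
   relation for this t is contradictory. *)
move=> /mnm_lepP/existsNP[t /negP]; rewrite -ltnNge => gt; exfalso.
pose h := z t - ev (Q t) * w.
have Qh : ev (Q t) * eval p = ev (Q t0) * h.
  by rewrite pw /h !mulrBr Qz; congr (_ - _); rewrite mulrCA.
have nJc b : ~ J b -> forall t, ~ J (cst (c t) * b).
  by move=> nJb t' /(power_ideal_const (c0 t')).
pose s := (a t + g)%MM.
have Z0 q : eval q = h -> eval (lift (Q t) * p - lift (Q t0) * q) = 0.
  by move=> qh; rewrite mevalB !mevalM !eval_lift qh Qh subrr.
have sp : supp_ge s (lift (Q t) * p) by apply: supp_geM => //; apply: lift_supp_ge.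
have spE : (lift (Q t) * p)@_s = cst (c t) * p@_g.
  by rewrite mcoeffM_lowest ?mcoeff_map_mpoly //; apply: lift_supp_ge.
(* Both sides of Q_t p = Q_t0 h are compared at their lowest exponents s and s'. If these differ, or
   if h has a representation of degree beyond s, a coefficient outside J would lie in J. *)
have [[q qh Dq]|[q [d [qh dq nJq]]]] := @initial_form r R f h (mdeg s).+1.
  have qs m : m \in msupp (lift (Q t0) * q) -> (s < m)%O.
    move=> /msuppM_le/allpairsP[[m1 m2] /= [_ /Dq m2D ->]].
    apply: lt_mdeg_ltmc; rewrite mdegD; apply: leq_trans m2D _; exact: leq_addl.
  apply: (nJc _ nJg t); rewrite -spE.
  have := lowest_coeff_ideal f_col (Z0 q qh) (g := s).
  rewrite mcoeffB [(lift (Q t0) * q)@_s]memN_msupp_eq0 ?subr0.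
    by apply; apply: supp_geD => //; apply: supp_geN => m /qs/ltW.
  by apply/negP => /qs; rewrite ltxx.
pose s' := (a t0 + d)%MM.
have s'q : supp_ge s' (lift (Q t0) * q) by apply: supp_geM => //; apply: lift_supp_ge.
have s'qE : (lift (Q t0) * q)@_s' = cst (c t0) * q@_d.
  by rewrite mcoeffM_lowest ?mcoeff_map_mpoly //; apply: lift_supp_ge.
case: (ltgtP s s') => [ss'|s's|].
- apply: (nJc _ nJg t); rewrite -spE.
  have := lowest_coeff_ideal f_col (Z0 q qh) (g := s).
  rewrite mcoeffB (supp_gt_coeff0 s'q ss') subr0; apply.
  by apply: supp_geD => //; apply: supp_geN => m /s'q; apply/le_trans/ltW.
- apply: (nJc _ nJq t0); rewrite -s'qE.
  have := lowest_coeff_ideal f_col (Z0 q qh) (g := s').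
  rewrite mcoeffB (supp_gt_coeff0 sp s's) sub0r => H.
  rewrite -[_@__]opprK -mulN1r; apply: idealM => //; apply: H.
  apply: supp_geD; first by move=> m /sp; apply/le_trans/ltW.
  exact: supp_geN.
(* For s = s', freeness of [Q t] from variable t makes the exponent of t in g at least that in
   [a t0]. *)
- move=> /mnmP/(_ t); rewrite !mnmDE (Qt t (a t)) ?mlast_supp // add0n => gE.
  by move: gt; rewrite gE ltnNge leq_addr.
Qed.

Variables (H : 'X_{1..r} -> Prop) (M C : nat).
Hypotheses (HD : forall s s', H s -> H s' -> H (s + s')%MM)
  (iota_image : forall p, (exists x, iota x = p) <-> (forall s, s \in msupp p -> H s))
  (H_tail : forall s i, H s -> (C <= s i)%N ->
     exists2 s', H s' & s = (s' + U_(i) *+ M)%MM).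

Lemma depth_criterion e (i j : 'I_r) : i != j ->
  H (e + U_(i) *+ M)%MM -> H (e + U_(j) *+ M)%MM -> H e.
Proof.
move=> ij Hi Hj; apply: contrapT => nHe.
(* The r - 1 elements f_l with l different from t are played against the r - 2 variables other than
   i and j: every monomial of the combination has exponent at least C in i or in j, so its product
   with X^e is in H. *)
have dep t : exists Q : {mpoly k[r]}, [/\ Q != 0, forall m, m \in msupp Q -> m t = 0%N &
    exists z, iota z = iota (ev Q) * 'X_[e]].
  have [|Q [Q0 QK Qs]] := @vanishing_combination k r r (fun l => iota (f l))
      [set~ t] (~: [set i; j]) C.
    rewrite cardsC1 cardsCs setCK cards2 ij card_ord.
    by move: ij (ltn_ord i) (ltn_ord j); rewrite -val_eqE /=; lia.
  exists Q; split=> // [m /QK Qm|]; first by apply: Qm; rewrite !inE eqxx.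
  apply/iota_image => s; rewrite (perm_mem (msuppMX _ _)) => /mapP[s' s'Q ->].
  have Hs' : H s' by apply: (iota_image (iota (ev Q))).1 => //; exists (ev Q).
  have step l : H (e + U_(l) *+ M)%MM -> (C <= s' l)%N -> H (e + s')%MM.
    move=> Hl /(H_tail Hs')[s'' Hs'' ->].
    by rewrite [(s'' + _)%MM]addmC addmA; apply: HD.
  have [Ci|Ci] := leqP C (s' i); first exact: step Hi Ci.
  have [Cj|Cj] := leqP C (s' j); first exact: step Hj Cj.
  move: s'Q; rewrite (iota_mmap iota_cst) mcoeff_msupp Qs ?eqxx // => l.
  by rewrite !inE negbK => /orP[]/eqP->.
have /all_sig[Q HQ] := fun t => cid (dep t).
have /all_sig[z Hz] : forall t, {z | iota z = iota (ev (Q t)) * 'X_[e]}.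
  by move=> t; apply: cid; have [] := HQ t.
have Qz t : ev (Q t) * z i = ev (Q i) * z t.
  by apply: iota_inj; rewrite !rmorphM /= !Hz mulrCA.
pose A := iota (ev (Q i)).
have A0 : A != 0.
  rewrite -(rmorph0 iota) (inj_eq iota_inj); apply: ev_neq0; by have [] := HQ i.
(* The order is taken just beyond the sum of the degrees of the lowest monomial of A and of X^e. *)
have [||p [w pw] pD] := @division_to_order Q i z (mdeg (mlast A) + mdeg e).+1 _ _ Qz.
- by move=> t; have [] := HQ t.
- by move=> t; have [] := HQ t.
(* As e is not in H, X^e survives in B; so the lowest monomial of A B has degree too small for the
   representation p. *)
pose B := 'X_[e] - iota w.
have Be : B@_e = 1.
  rewrite mcoeffB mcoeffX eqxx memN_msupp_eq0 ?subr0 //; apply/negP => ew; apply: nHe.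
  by apply: (iota_image (iota w)).1 => //; exists w.
have eB : e \in msupp B by rewrite mcoeff_msupp Be oner_eq0.
have B0 : B != 0 by apply: contraTneq eB => ->; rewrite msupp0.
have ABE : iota (eval p) = A * B by rewrite pw rmorphB rmorphM /= Hz mulrBr.
have : (A * B)@_(mlast A + mlast B) != 0.
  by rewrite mcoeffM_lowest ?mulf_neq0 ?mlast_coeff_neq0 //; apply: mlast_ge.
rewrite -ABE -mcoeff_msupp => ABs.
suff low m : m \in msupp (iota (eval p)) -> ((mdeg (mlast A) + mdeg e).+1 <= mdeg m)%N.
  have := low _ ABs; rewrite mdegD ltn_add2l ltnNge.
  by rewrite (lemc_mdeg (mlast_lemc eB)).
rewrite mevalE rmorph_sum /= => /msupp_sum_le/flattenP[_ /mapP[m' m'p ->]].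
rewrite rmorphM /= => /msuppM_le/allpairsP[[m1 m2] /= [_ m2f ->]].
apply: leq_trans (pD m' _) _; first by move: m'p; rewrite mem_filter.
by rewrite mdegD (leq_trans (mdeg_monomial_lower m2f)) ?leq_addl.
Qed.

End DepthCriterion.

(** * Subrings of a polynomial ring spanned by monomials *)

Section MonomialSubring.
Variables (k : fieldType) (n r M : nat) (R : comNzRingType).
Variables (cst : {rmorphism k -> R}) (iota : {rmorphism R -> {mpoly k[r]}}).
Hypotheses (iota_inj : injective iota) (iota_cst : forall c, iota (cst c) = c%:MP).
Variables (mu : 'I_n -> 'X_{1..r}) (y : 'I_r -> 'I_n) (x : 'I_n -> R).
Hypotheses (M_gt0 : (0 < M)%N) (mu_y : forall i, mu (y i) = (U_(i) *+ M)%MM)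
  (iota_x : forall j, iota (x j) = 'X_[mu j]).

Definition weight (m : 'X_{1..n}) : 'X_{1..r} := (\sum_j mu j *+ m j)%MM.

Definition weight_monoid (s : 'X_{1..r}) := exists m, s = weight m.
Local Notation H := weight_monoid.

Hypothesis iota_supp : forall z s, s \in msupp (iota z) -> H s.

Local Notation pi := (mmap cst x).

Lemma weightE m i : weight m i = (\sum_j mu j i * m j)%N.
Proof. by rewrite /weight mnm_sumE; apply: eq_bigr => j _; rewrite mulmnE. Qed.

Lemma weightD m m' : weight (m + m')%MM = (weight m + weight m')%MM.
Proof.
apply/mnmP => i; rewrite mnmDE !weightE -big_split; apply: eq_bigr => j _.
by rewrite /= mnmDE mulnDr.
Qed.

Lemma weight0 : weight 0%MM = 0%MM.
Proof. by apply/mnmP => i; rewrite weightE mnm0E big1 // => j _; rewrite mnm0E muln0. Qed.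

Lemma weight1 j : weight U_(j)%MM = mu j.
Proof.
apply/mnmP => i; rewrite weightE (bigD1 j) //= mnm1E eqxx muln1 big1 ?addn0 // => l lj.
by rewrite mnm1E eq_sym (negPf lj) muln0.
Qed.

Lemma weightMn m e : weight (m *+ e)%MM = (weight m *+ e)%MM.
Proof.
elim: e => [|e IH]; first by rewrite !mulm0n weight0.
by rewrite !mulmS weightD IH.
Qed.

Lemma iota_pi Q : iota (pi Q) = \sum_(m <- msupp Q) Q@_m *: 'X_[weight m].
Proof.
rewrite (iota_mmap iota_cst) /mmap; apply: eq_bigr => m _; rewrite mul_mpolyC; congr (_ *: _).
rewrite /mmap1 /weight; under [LHS]eq_bigr do rewrite iota_x mpolyXn.
by rewrite mprodXE.
Qed.

Lemma pi_surj z : exists Q, z = pi Q.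
Proof.
have /all_sig[g Hg] : forall s, {m | s \in msupp (iota z) -> s = weight m}.
  move=> s; apply: cid; have [/iota_supp[m ->]|_] := boolP (s \in _); first by exists m.
  by exists 0%MM.
exists (\sum_(s <- msupp (iota z)) (iota z)@_s *: 'X_[g s]); apply: iota_inj.
rewrite (raddf_sum (mmap cst x)) rmorph_sum [LHS]mpolyE big_seq [RHS]big_seq.
apply: eq_bigr => s sz; rewrite /= mmapZ rmorphM /= iota_cst mul_mpolyC; congr (_ *: _).
by rewrite iota_pi msuppX big_seq1 mcoeffX eqxx scale1r -Hg.
Qed.

Lemma iota_image p : (exists z, iota z = p) <-> (forall s, s \in msupp p -> H s).
Proof.
split=> [[z <-] s|pH]; first exact: iota_supp.
rewrite [p]mpolyE big_seq; apply: (big_ind (fun p => exists z, iota z = p)).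
- by exists 0; rewrite rmorph0.
- by move=> _ _ [z <-] [w <-]; exists (z + w); rewrite rmorphD.
move=> s /pH[m ->]; exists (pi (p@_(weight m) *: 'X_[m])).
rewrite mmapZ rmorphM /= iota_cst mul_mpolyC iota_pi msuppX big_seq1 mcoeffX eqxx.
by rewrite scale1r.
Qed.

(** If coordinate i is large, some generator j with [mu j i] positive occurs at least M times. Since
    M mu_j is a combination of the M e_l, these copies can be exchanged for generators [y l], among
    them [y i]. *)
Lemma weight_tail : exists C, forall s i, H s -> (C <= s i)%N ->
  exists2 s', H s' & s = (s' + U_(i) *+ M)%MM.
Proof.
exists (\sum_i \sum_j mu j i * M).+1 => _ i [m ->] Ci.
have [j mj muji] : exists2 j, (M <= m j)%N & (0 < mu j i)%N.
  apply: contrapT => noj; move: Ci; apply/negP; rewrite -ltnNge ltnS (bigD1 i) //=.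
  apply: leq_trans (leq_addr _ _); rewrite weightE; apply: leq_sum => j _.
  have [->//|] := posnP (mu j i); rewrite ?mul0n // => muji.
  rewrite leq_mul2l; apply/orP; right; rewrite leqNgt; apply/negP => Mm.
  by apply: noj; exists j => //; apply: ltnW.
pose w : 'X_{1..n} := (\sum_l U_(y l) *+ mu j l)%MM.
have wE : weight w = (mu j *+ M)%MM.
  rewrite /w (big_morph weight weightD weight0); apply/mnmP => l.
  rewrite mnm_sumE (bigD1 l) //= weightMn weight1 mu_y !mulmnE mnm1E eqxx mul1n.
  rewrite big1 ?addn0 1?mulnC // => l' l'l.
  by rewrite weightMn weight1 mu_y !mulmnE mnm1E (negPf l'l) !mul0n.
exists (weight (m - U_(j) *+ M)%MM + weight (w - U_(y i))%MM)%MM.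
  by exists (m - U_(j) *+ M + (w - U_(y i)))%MM; rewrite weightD.
rewrite -mu_y -weight1 -addmA -weightD submK.
  rewrite wE -weight1 -weightMn -weightD submK //.
  by apply/mnm_lepP => l; rewrite mulmnE mnm1E; case: eqP => [<-|_]; rewrite ?mul1n.
apply/mnm_lepP => l; rewrite mnm1E; case: eqP => [<-|_] //.
rewrite /w mnm_sumE (bigD1 i) //= mulmnE mnm1E eqxx mul1n.
exact: leq_trans muji (leq_addr _ _).
Qed.

Definition vanishing_ideal : {pred R} := fun z => (iota z)@_0 == 0.

Lemma vanishing_ideal_maximal : maximal_ideal vanishing_ideal.
Proof.
have idV : idealr_closed vanishing_ideal.
  split; first by rewrite unfold_in rmorph0 mcoeff0.
    by rewrite unfold_in rmorph1 mcoeff1 eqxx oner_eq0.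
  move=> a u v; rewrite !unfold_in => /eqP u0 /eqP v0.
  by rewrite rmorphD rmorphM mcoeffD rmorphM /= u0 v0 mulr0 addr0.
split=> // I idI VI z zI; apply: contraT => z0.
have idI' := idealr_ideal idI.
case/negP: (rmorph_unit_notin cst idI z0).
have -> : cst (iota z)@_0 = z - (z - cst (iota z)@_0) by rewrite subKr.
apply: (idealB idI') => //; apply: VI; rewrite unfold_in rmorphB mcoeffB iota_cst.
by rewrite mcoeffC eqxx mulr1 subrr.
Qed.

Definition kill_vars i : 'I_r -> {mpoly k[r]} := fun j => if (j < i)%N then 0 else 'X_j.

(** The contraction to R of the prime ideal (X_0, ..., X_(i-1)) of the polynomial ring. *)
Definition face_ideal i : {pred R} := fun z => mmap (@mpolyC r k) (kill_vars i) (iota z) == 0.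

Lemma face_idealE i z :
  (z \in face_ideal i) = (mmap (@mpolyC r k) (kill_vars i) (iota z) == 0).
Proof. by []. Qed.

Lemma face_ideal_prime i : prime_ideal (face_ideal i).
Proof.
split=> [|u v]; last by rewrite !face_idealE !rmorphM mulf_eq0.
split; first by rewrite face_idealE !rmorph0.
  by rewrite face_idealE !rmorph1 oner_eq0.
move=> a u v; rewrite !face_idealE => /eqP u0 /eqP v0.
by rewrite rmorphD rmorphM raddfD /= rmorphM /= u0 v0 mulr0 addr0.
Qed.

(** Consecutive ideals are separated by [x (y i)], which [iota] sends to X_i^M. *)
Lemma face_ideal_chain i : (i < r)%N ->
  {subset face_ideal i <= face_ideal i.+1} /\ ~ {subset face_ideal i.+1 <= face_ideal i}.
Proof.
move=> ir; split=> [z zi|].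
  have /eqP z0 : mmap (@mpolyC r k) (kill_vars i) (iota z) == 0 by rewrite -face_idealE.
  rewrite face_idealE.
  have -> : mmap (@mpolyC r k) (kill_vars i.+1) (iota z) =
      mmap (@mpolyC r k) (kill_vars i.+1) (mmap (@mpolyC r k) (kill_vars i) (iota z)).
    rewrite (iota_mmap (cst := @mpolyC r k)) => [|c]; last exact: mmapC.
    rewrite /mmap; apply: eq_bigr => m _; congr (_ * _); apply: mmap1_eq => j.
    rewrite /kill_vars; case: (ltnP j i) => ji; first by rewrite (leqW ji) rmorph0.
    by rewrite /= mmapX mmap1U.
  by rewrite z0 rmorph0.
pose o := Ordinal ir.
have ev l : mmap (@mpolyC r k) (kill_vars l) (iota (x (y o))) = kill_vars l o ^+ M.
  by rewrite iota_x mu_y mmapX mmap1Mn mmap1U.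
move=> /(_ (x (y o))) sub.
have: x (y o) \in face_ideal i.
  by apply: sub; rewrite face_idealE ev /kill_vars /= ltnSn expr0n eqn0Ngt M_gt0 eqxx.
rewrite face_idealE ev /kill_vars /= ltnn expf_eq0 M_gt0 /=.
by rewrite -msupp_eq0 msuppX.
Qed.

Lemma face_ideal_last : face_ideal r =i vanishing_ideal.
Proof.
move=> z; rewrite face_idealE [RHS]unfold_in.
have -> : mmap (@mpolyC r k) (kill_vars r) (iota z) = ((iota z)@_0)%:MP.
  rewrite [in LHS](mpolyE (iota z)) raddf_sum /=.
  have term m : m != 0%MM -> mmap (@mpolyC r k) (kill_vars r) ((iota z)@_m *: 'X_[m]) = 0.
    rewrite mmapZ mmapX -mdeg_eq0 mdegE sum_nat_eq0 => /forallPn[j]; rewrite implyTb => mj.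
    rewrite /mmap1 (bigD1 j) //= /kill_vars ltn_ord expr0n (negPf mj).
    by rewrite mul0r mulr0.
  have [z0|z0] := boolP (0%MM \in msupp (iota z)).
    rewrite (bigD1_seq 0%MM) ?msupp_uniq //= big1 => [|m /term //].
    by rewrite addr0 mmapZ mmapX mmap11 mulr1.
  rewrite (memN_msupp_eq0 z0) mpolyC0 big_seq big1 // => m mz; apply: term.
  by apply: contra z0 => /eqP <-.
by rewrite mpolyC_eq0.
Qed.

(** The face ideals show that the vanishing ideal has height at least r. Its depth is the same, so
    it contains a regular sequence whose first r elements serve in the depth criterion. *)
Lemma cohen_macaulay_condition : cohen_macaulay R ->
  forall e (i j : 'I_r), i != j ->
  H (e + U_(i) *+ M)%MM -> H (e + U_(j) *+ M)%MM -> H e.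
Proof.
move=> [_ /(_ _ vanishing_ideal_maximal)[d [[xs [xs_reg xsV xs_size]] _] [_ ht]]].
have rd : (r <= d)%N.
  apply: ht; exists face_ideal; split=> [i _|i|]; first exact: face_ideal_prime.
    exact: face_ideal_chain.
  exact: face_ideal_last.
have [C H_tail] := weight_tail.
have f_col : colon_powers (fun i => xs`_i) r.
  apply: regular_colon_powers => i ir z.
  have ixs : (i < size xs)%N by rewrite xs_size; apply: leq_trans rd.
  have [reg _] := xs_reg.
  by rewrite -!ideal_generated_power ?(ltnW ixs) //; apply: reg.
have f_max i : (i < r)%N -> (iota xs`_i)@_0 = 0.
  move=> ir; apply/eqP; apply: (xsV xs`_i); apply: mem_nth.
  by rewrite xs_size; apply: leq_trans rd.
have HD s s' : H s -> H s' -> H (s + s')%MM.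
  by move=> [m ->] [m' ->]; exists (m + m')%MM; rewrite weightD.
exact: (depth_criterion iota_inj iota_cst f_col f_max HD iota_image H_tail).
Qed.

End MonomialSubring.

(** * Linear maps prescribed on monomials *)

Section LinearExtension.
Variables (k : fieldType) (r n : nat) (h : 'X_{1..r} -> 'X_{1..n}).

Definition linear_extension (p : {mpoly k[r]}) : {mpoly k[n]} :=
  \sum_(m <- msupp p) p@_m *: 'X_[h m].

Lemma linear_extensionE K p : (msize p <= K)%N ->
  linear_extension p = \sum_(m : 'X_{1..r < K}) p@_m *: 'X_[h m].
Proof.
move=> pK; pose I : subFinType _ := 'X_{1..r < K}.
rewrite /linear_extension (big_mksub I) ?msupp_uniq //=; last first.
  by move=> m /msize_mdeg_lt /leq_trans; apply.
by rewrite big_rmcond //= => m /memN_msupp_eq0 ->; rewrite scale0r.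
Qed.

Lemma linear_extension_is_linear : linear linear_extension.
Proof.
move=> c p q; pose K := maxn (msize (c *: p + q)) (maxn (msize p) (msize q)).
rewrite !(@linear_extensionE K) ?leq_max ?leqnn ?orbT //.
rewrite scaler_sumr -big_split; apply: eq_bigr => m _.
by rewrite /= mcoeffD mcoeffZ scalerDl scalerA.
Qed.

HB.instance Definition _ :=
  GRing.isLinear.Build k {mpoly k[r]} {mpoly k[n]} _ linear_extension
    linear_extension_is_linear.

Lemma linear_extensionX m : linear_extension 'X_[m] = 'X_[h m].
Proof. by rewrite /linear_extension msuppX big_seq1 mcoeffX eqxx scale1r. Qed.

End LinearExtension.

Lemma rmorph_mmap (k R K : comNzRingType) (c : {rmorphism k -> R}) (h : {rmorphism R -> K})
    n (x : 'I_n -> R) (Q : {mpoly k[n]}) :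
  h (mmap c x Q) = mmap (h \o c) (h \o x) Q.
Proof.
rewrite /mmap rmorph_sum; apply: eq_bigr => m _; rewrite rmorphM /=; congr (_ * _).
by rewrite /mmap1 rmorph_prod; apply: eq_bigr => i _; rewrite rmorphXn.
Qed.

Lemma mmap_univariate (k : fieldType) (R : comNzRingType) (c : {rmorphism k -> R}) z
    (Q : {mpoly k[1]}) : Q != 0 ->
  exists2 f : {poly k}, f != 0 & (map_poly c f).[z] = mmap c (fun=> z) Q.
Proof.
move=> Q0; exists (\sum_(m <- msupp Q) Q@_m *: 'X^(m ord0)).
  have eq0 (m m' : 'X_{1..1}) : m ord0 = m' ord0 -> m = m'.
    by move=> E; apply/mnmP => i; rewrite !ord1.
  apply/eqP => /polyP/(_ (mlead Q ord0)); rewrite coef0 coef_sum.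
  rewrite (bigD1_seq (mlead Q)) ?msupp_uniq ?mlead_supp //= coefZ coefXn eqxx mulr1.
  rewrite big1 ?addr0 => [/eqP|m mQ]; first by rewrite mleadc_eq0 (negPf Q0).
  rewrite coefZ coefXn; case: eqP => [/esym/eq0 E|_]; last by rewrite mulr0.
  by rewrite E eqxx in mQ.
rewrite rmorph_sum horner_sum; apply: eq_bigr => m _.
by rewrite /= map_polyZ map_polyXn hornerZ hornerXn /mmap1 big_ord1.
Qed.

(** * Algebraicity of residue fields *)

Section MaximalIdeal.
Variables (k : fieldType) (n N : nat) (R : comNzRingType) (cst : {rmorphism k -> R}).
Variable x : 'I_n -> R.
Hypotheses (gen : forall z, exists Q, z = mmap cst x Q)
  (dep : forall z : 'I_N -> R, exists2 Q : {mpoly k[N]}, Q != 0 & mmap cst z Q = 0).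

(** The residue field R/P is a finitely generated k-algebra without N independent elements, so
    Zariski's lemma makes the class of z algebraic over k. *)
Lemma maximal_algebraic (P : {pred R}) z : maximal_ideal P ->
  exists2 f : {poly k}, f != 0 & (map_poly cst f).[z] \in P.
Proof.
move=> maxP; have [idP _] := maxP.
pose P' : idealr R := HB.pack (P : R -> bool) (isIdealr.Build R P idP).
pose K := {ideal_quot P'}.
pose h : {rmorphism R -> K} := \pi_K%qT.
have hP u : (h u == 0) = (u \in P).
  by rewrite -[u in RHS]subr0 (Quotient.idealrBE P') /= -(rmorph0 h).
have h_surj (w : K) : exists u, w = h u.
  by exists (repr w); rewrite /h /= reprK.
have K_field (w : K) : w != 0 -> exists c, c * w = 1.
  have [u ->] := h_surj w; rewrite hP => /(maximal_inv maxP)[a].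
  rewrite -hP rmorphB rmorph1 rmorphM subr_eq0 => /eqP ->.
  by exists (h a).
have /existsNP[Q /not_implyP[Qz /eqP Q0]] :
    ~ independent (h \o cst : {rmorphism _ -> _}) (fun _ : 'I_1 => h z).
  apply: (zariski_lemma K_field (g := h \o x) (N := N)) => [w|w wind].
    have [u ->] := h_surj w; have [Q ->] := gen u.
    by exists Q; rewrite rmorph_mmap.
  have /all_sig[u Hu] : forall i, {u | w i = h u} by move=> i; apply: cid.
  have [Q /eqP Q0 Qu] := dep u; apply/Q0/wind.
  rewrite -[RHS](rmorph0 h) -Qu rmorph_mmap /mmap; apply: eq_bigr => m _.
  by congr (_ * _); apply: mmap1_eq.
have [f f0 fz] := mmap_univariate cst z Q0; exists f => //.
by rewrite fz -hP rmorph_mmap; apply/eqP.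
Qed.

End MaximalIdeal.

(** * Cohen-Macaulayness from a section by standard monomials *)

Section StandardMonomials.
Variables (k : fieldType) (n r M : nat) (R : comNzRingType).
Variables (cst : {rmorphism k -> R}) (iota : {rmorphism R -> {mpoly k[r]}}).
Hypotheses (iota_inj : injective iota) (iota_cst : forall c, iota (cst c) = c%:MP).
Variables (mu : 'I_n -> 'X_{1..r}) (y : 'I_r -> 'I_n) (x : 'I_n -> R).
Hypotheses (y_inj : injective y) (mu_y : forall i, mu (y i) = (U_(i) *+ M)%MM)
  (iota_x : forall j, iota (x j) = 'X_[mu j]).
Local Notation H := (weight_monoid mu).
Hypothesis iota_supp : forall z s, s \in msupp (iota z) -> H s.

(* [sigma s] is the standard monomial of degree s. *)
Variable sigma : 'X_{1..r} -> 'X_{1..n}.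
Hypotheses (sigmaK : forall s, H s -> weight mu (sigma s) = s)
  (sigmaD : forall s i, H s -> sigma (s + U_(i) *+ M)%MM = (sigma s + U_(y i))%MM).

Local Notation pi := (mmap cst x).

Definition normal_form z : {mpoly k[n]} := linear_extension sigma (iota z).

Lemma pi_normal_form z : pi (normal_form z) = z.
Proof.
apply: iota_inj; rewrite /normal_form /linear_extension (raddf_sum (mmap cst x)) rmorph_sum.
rewrite [RHS]mpolyE big_seq [RHS]big_seq; apply: eq_bigr => s sz /=.
rewrite mmapZ rmorphM /= iota_cst mul_mpolyC; congr (_ *: _).
rewrite (iota_pi iota_cst iota_x) msuppX big_seq1 mcoeffX eqxx scale1r sigmaK //.
exact: iota_supp sz.
Qed.

Lemma normal_form_var i z : normal_form (x (y i) * z) = 'X_(y i) * normal_form z.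
Proof.
rewrite /normal_form rmorphM /= iota_x mu_y.
rewrite [X in _ * X]mpolyE mulr_sumr raddf_sum /= [in RHS]/linear_extension mulr_sumr.
rewrite big_seq [RHS]big_seq; apply: eq_bigr => s sz.
rewrite -!scalerAr -mpolyXD linearZ /= linear_extensionX -mpolyXD; congr (_ *: 'X_[_]).
by rewrite addmC sigmaD 1?addmC //; apply: iota_supp sz.
Qed.

Lemma normal_formD z w : normal_form (z + w) = normal_form z + normal_form w.
Proof. by rewrite /normal_form rmorphD raddfD. Qed.

Lemma normal_formZ c z : normal_form (cst c * z) = c *: normal_form z.
Proof. by rewrite /normal_form rmorphM /= iota_cst mul_mpolyC linearZ. Qed.

Lemma normal_form_varX i e z :
  normal_form (x (y i) ^+ e * z) = 'X_[U_(y i) *+ e] * normal_form z.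
Proof.
elim: e => [|e IH]; first by rewrite mulm0n mpolyX0 !mul1r.
by rewrite exprS -mulrA normal_form_var IH mulmS mpolyXD mulrA.
Qed.

Lemma normal_form_poly (f : nat -> {poly k}) (v : nat -> 'I_n) i j z : v j = y i ->
  normal_form (pi (mpoly_of_poly f v j) * z) = mpoly_of_poly f v j * normal_form z.
Proof.
move=> vj; rewrite (raddf_sum (mmap cst x)) !mulr_suml.
rewrite (big_morph normal_form normal_formD (id1 := 0)); last first.
  by rewrite /normal_form rmorph0 raddf0.
apply: eq_bigr => e _; rewrite /= mmapZ mmapX mmap1Mn mmap1U -mulrA normal_formZ vj.
by rewrite normal_form_varX scalerAl.
Qed.

(** The normal form carries a relation among the elements f_i(x_(y i)) of P to the polynomial ring,
    where the f_i are regular, and [pi] carries the conclusion back. *)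
Lemma maximal_regular_sequence (P : {pred R}) : maximal_ideal P ->
  exists xs, [/\ regular_sequence xs, {subset xs <= P} & size xs = r].
Proof.
move=> maxP; have [idP _] := maxP; have idP' := idealr_ideal idP.
have proper (xs : seq R) : {subset xs <= P} -> ~ ideal_generated (fun z => z \in xs) 1.
  move=> xsP /(ideal_generated_min idP' xsP) P1.
  by case: idP => _ /negP.
have [r0|r_gt0] := posnP r.
  by exists [::]; split=> //; split=> //; apply: proper.
have dep (z : 'I_r.+1 -> R) : exists2 Q : {mpoly k[r.+1]}, Q != 0 & mmap cst z Q = 0.
  by apply: (algebraic_dependence iota_inj iota_cst).
have gen := pi_surj iota_inj iota_cst iota_x iota_supp.
(* [insubd] extends the indexing to all naturals by sending indices from r on to 0; only those below
   r enter the sequence. *)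
have alg (i : nat) := maximal_algebraic gen dep (x (y (insubd (Ordinal r_gt0) i))) maxP.
pose v i := y (insubd (Ordinal r_gt0) i).
have /all_sig[f Hf] : forall i : nat,
    {f : {poly k} | f != 0 & (map_poly cst f).[x (v i)] \in P}.
  by move=> i; apply: cid2; apply: alg.
have v_inj i j : (i < r)%N -> (j < r)%N -> v i = v j -> i = j.
  move=> ir jr /y_inj/(congr1 val).
  by rewrite !val_insubd ir jr.
pose F := mpoly_of_poly f v.
have piFE i : pi (F i) = (map_poly cst (f i)).[x (v i)].
  rewrite (raddf_sum (mmap cst x)) (horner_coef_wide (n := size (f i))) ?size_poly //.
  by apply: eq_bigr => e _; rewrite coef_map /= mmapZ mmapX mmap1Mn mmap1U.
pose xs := [seq pi (F i) | i <- seq.iota 0 r].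
have xs_size : size xs = r by rewrite size_map size_iota.
have xsE i : (i < r)%N -> xs`_i = pi (F i).
  by move=> ir; rewrite (nth_map 0%N) ?size_iota // nth_iota.
have xsP : {subset xs <= P}.
  by move=> _ /mapP[i _ ->]; rewrite piFE; have [] := Hf i.
exists xs; split=> //; split; last exact: proper.
rewrite xs_size => i z ir.
rewrite !ideal_generated_power ?xs_size ?(ltnW ir) // => -[c cE].
have : power_ideal F i (fun=> 1%N) (normal_form z).
  apply: (@mpoly_of_poly_regular k n r f v) => //.
    by move=> j _; have [] := Hf j.
  exists (fun j => normal_form (c j)).
  rewrite -/(F i) -(normal_form_poly f (i := insubd (Ordinal r_gt0) i)) //.
  rewrite -/F -xsE // cE (big_morph normal_form normal_formD (id1 := 0)); last first.
    by rewrite /normal_form rmorph0 raddf0.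
  apply: eq_bigr => j _; rewrite !expr1 mulrC xsE; last exact: ltn_trans (ltn_ord j) ir.
  by rewrite /F (normal_form_poly f (i := insubd (Ordinal r_gt0) j)) // mulrC.
move=> [e eE]; exists (fun j => pi (e j)).
rewrite -[LHS]pi_normal_form eE (raddf_sum (mmap cst x)); apply: eq_bigr => j _ /=.
by rewrite rmorphM !expr1 xsE //; exact: ltn_trans (ltn_ord j) ir.
Qed.

Lemma standard_cohen_macaulay : cohen_macaulay R.
Proof.
split.
  apply: (noetherian_quotient (h := mmap cst x)).
  exact: (pi_surj iota_inj iota_cst iota_x iota_supp).
move=> P maxP; have [xs [xs_reg xsP xs_size]] := maximal_regular_sequence maxP.
have primeP := maximal_prime maxP.
exists r; split; first by exists xs.
- move=> m [ys [ys_reg ysP <-]].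
  have [p [pprime pstrict _]] := regular_sequence_chain primeP ys_reg ysP.
  exact: (prime_chain_length iota_inj iota_cst pprime pstrict).
- by rewrite -xs_size; apply: regular_sequence_chain.
- move=> m [p [pprime pstrict _]].
  exact: (prime_chain_length iota_inj iota_cst pprime pstrict).
Qed.

End StandardMonomials.

(** * Monomial ideals and the reverse lexicographic order *)

Section MonomialIdeals.
Variables (k : fieldType) (n : nat).
Implicit Types (G : 'X_{1..n} -> Prop) (f : {mpoly k[n]}).

Lemma monomial_idealP G f :
  monomial_ideal G f <-> forall m, m \in msupp f -> exists2 g, G g & (g <= m)%MM.
Proof.
split=> [|fG].
  apply: (ideal_generated_min (J := fun f => forall m, m \in msupp f -> exists2 g, G g & (g <= m)%MM)).
    split=> [m|a u v Ju Jv m]; first by rewrite msupp0.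
    move=> /msuppD_le; rewrite mem_cat => /orP[|/Jv//].
    move=> /msuppM_le/allpairsP[[m1 m2] /= [_ /Ju[g Gg gm] ->]].
    by exists g => //; apply: lepm_trans gm (lem_addl _ _).
  by move=> _ [g Gg ->] m; rewrite msuppX inE => /eqP->; exists g; rewrite ?lepm_refl.
have idG := ideal_generated_ideal (fun g : {mpoly k[n]} => exists2 m, G m & g = 'X_[m]).
rewrite [f]mpolyE big_seq; apply: ideal_sum => // m /fG[g Gg gm].
rewrite -(submK gm) mpolyXD scalerAl; apply: idealM => //.
by apply: sub_ideal_generated; exists g.
Qed.

End MonomialIdeals.

Section ReverseLex.
Variables (n : nat) (le_var : rel 'I_n).
Hypothesis (le_total : total_order le_var).
Implicit Types m : 'X_{1..n}.

(** The tie-breaking clause of [Agrevlex_lt], which decides between monomials of equal degree. *)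
Definition revlex_lt m' m := exists i : 'I_n, (m i < m' i)%N /\
  forall j, j != i -> le_var j i -> m j = m' j.

Lemma revlex_lt_irr m : ~ revlex_lt m m.
Proof. by case=> i []; rewrite ltnn. Qed.

Lemma revlex_lt_trans m1 m2 m3 : revlex_lt m1 m2 -> revlex_lt m2 m3 -> revlex_lt m1 m3.
Proof.
have [le_refl le_anti le_trans le_tot] := le_total.
move=> [i [mi Hi]] [j [mj Hj]].
have [E|ij] := eqVneq i j.
  rewrite -E in Hj mj; by exists i; split=> [|l li lei]; [apply: ltn_trans mi | rewrite Hj ?Hi].
have [leij|leji] := orP (le_tot i j).
  exists i; split=> [|l li lei]; first by rewrite Hj.
  have lj : l != j.
    apply: contra ij => /eqP lj; apply/eqP/le_anti; rewrite leij /=.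
    by rewrite -lj lei.
  by rewrite Hj ?Hi //; apply: le_trans leij.
exists j; split=> [|l lj lej]; first by rewrite -(Hi j) // eq_sym.
have li : l != i.
  apply: contra ij => /eqP li; apply/eqP/le_anti; rewrite leji andbT.
  by rewrite -li lej.
by rewrite Hj ?Hi //; apply: le_trans leji.
Qed.

Lemma revlex_lt_total m m' : m != m' -> revlex_lt m m' \/ revlex_lt m' m.
Proof.
have [le_refl le_anti le_trans le_tot] := le_total; move=> mm'.
(* The head of D is the smallest variable at which m and m' differ. *)
pose D := sort le_var [seq i <- enum 'I_n | m i != m' i].
have memD i : (i \in D) = (m i != m' i) by rewrite mem_sort mem_filter mem_enum andbT.
have sD : sorted le_var D by apply: sort_sorted.
case DE : D sD memD => [|i D'] /= sD memD.
  case/eqP: mm'; apply/mnmP => i; apply/eqP.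
  by have := memD i; rewrite in_nil => /esym/negbFE.
have imin j : m j != m' j -> le_var i j.
  rewrite -memD inE => /orP[/eqP->|]; first exact: le_refl.
  by have /allP := order_path_min le_trans sD; apply.
have low j : j != i -> le_var j i -> m j = m' j.
  move=> ji leji; apply/eqP; apply: contraT => /imin leij.
  by case/eqP: ji; apply: le_anti; rewrite leji leij.
have := memD i; rewrite mem_head => /esym; rewrite neq_ltn => /orP[mi|mi].
  by right; exists i; split.
by left; exists i; split=> // j ji leji; rewrite low.
Qed.

Lemma revlex_lt_add c m m' : revlex_lt (m + c)%MM (m' + c)%MM <-> revlex_lt m m'.
Proof.
split=> -[i [mi Hi]]; exists i; split.
- by move: mi; rewrite !mnmDE ltn_add2r.
- by move=> j ji leji; have := Hi j ji leji; rewrite !mnmDE => /addIn.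
- by rewrite !mnmDE ltn_add2r.
- by move=> j ji leji; rewrite !mnmDE Hi.
Qed.

(** Without the degree the order need not be well founded, as powers of a variable descend; minimal
    elements are therefore sought in finite sets. *)
Lemma revlex_minimal (V : 'X_{1..n} -> Prop) (l : seq 'X_{1..n}) :
    (forall m, V m -> m \in l) -> (exists m, V m) ->
  exists2 m, V m & forall m', V m' -> ~ revlex_lt m' m.
Proof.
elim: l V => [|m0 l IH] V Vl [m Vm]; first by have := Vl m Vm.
have [[m1 [Vm1 m10]]|noV] := pselect (exists m1, V m1 /\ m1 != m0); last first.
  exists m => // m' Vm'; suff -> : m' = m by apply: revlex_lt_irr.
  have eq0 m1 : V m1 -> m1 = m0.
    by move=> Vm1; apply/eqP; apply: contraT => m10; case: noV; exists m1.
  by rewrite (eq0 m) // (eq0 m').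
have [||m2 [Vm2 m20] m2min] := IH (fun m => V m /\ m != m0).
- by move=> m' [/Vl + m'0]; rewrite inE (negPf m'0).
- by exists m1.
have [[Vm0 m02]|nm0] := pselect (V m0 /\ revlex_lt m0 m2); last first.
  exists m2 => // m' Vm'; have [E|m'0] := eqVneq m' m0; last exact: m2min.
  by rewrite E in Vm' * => m02; apply: nm0.
exists m0 => // m' Vm' m'0; have [E|m'n] := eqVneq m' m0.
  by apply: (@revlex_lt_irr m0); rewrite -{1}E.
by apply: (m2min m') => //; apply: revlex_lt_trans m02.
Qed.

End ReverseLex.

(** * Standard monomials and minimal nonstandard ones *)

Section NonStandardMonomials.
Variables (k : fieldType) (n r M : nat) (le_var : rel 'I_n).
Variables (mu : 'I_n -> 'X_{1..r}) (y : 'I_r -> 'I_n).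
Hypotheses (le_total : total_order le_var) (M_gt0 : (0 < M)%N)
  (mu_y : forall i, mu (y i) = (U_(i) *+ M)%MM) (mu_neq0 : forall j, mu j != 0%MM)
  (y_small : forall v i, le_var v (y i) -> exists j, v = y j).
Local Notation wt := (weight mu).
Local Notation H := (weight_monoid mu).
Local Notation rlt := (revlex_lt le_var).
Implicit Types (m g : 'X_{1..n}) (s : 'X_{1..r}).

Definition nonstandard m := exists2 m', wt m' = wt m & rlt m' m.

Lemma weight_yD m i : wt (m + U_(y i))%MM = (wt m + U_(i) *+ M)%MM.
Proof. by rewrite weightD weight1 mu_y. Qed.

Lemma nonstandardD c m : nonstandard m -> nonstandard (m + c)%MM.
Proof.
move=> [m' wE mm']; exists (m' + c)%MM; first by rewrite !weightD wE.
exact/revlex_lt_add.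
Qed.

Lemma nonstandardW m m' : nonstandard m -> (m <= m')%MM -> nonstandard m'.
Proof. by move=> nm /submK <-; rewrite addmC; apply: nonstandardD. Qed.

(** This makes the set of monomials of a given weight finite. *)
Lemma mdeg_weight m : (mdeg m <= mdeg (wt m))%N.
Proof.
rewrite [X in (X <= _)%N]mdegE /weight mdeg_sum; apply: leq_sum => j _.
by rewrite mdegMn leq_pmull // lt0n mdeg_eq0.
Qed.

Lemma standard_exists s : H s -> exists2 m, wt m = s & ~ nonstandard m.
Proof.
move=> [m0 m0E]; have [m mE||m mE mmin] := @revlex_minimal n le_var le_total (fun m => wt m = s)
    [seq val b | b : 'X_{1..n < (mdeg s).+1}].
- have mD : (mdeg m < (mdeg s).+1)%N by rewrite ltnS -mE mdeg_weight.
  by apply/mapP; exists (BMultinom mD); rewrite ?mem_enum.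
- by exists m0.
by exists m => // -[m' wE]; apply: mmin; rewrite wE.
Qed.

Lemma standard_unique m m' : wt m = wt m' -> ~ nonstandard m -> ~ nonstandard m' -> m = m'.
Proof.
move=> wE nm nm'; apply/eqP; apply: contraT => /(revlex_lt_total le_total)[mm'|m'm].
  by case: nm'; exists m.
by case: nm; exists m'.
Qed.

Definition minimal_nonstandard m :=
  nonstandard m /\ forall m', nonstandard m' -> (m' <= m)%MM -> m' = m.

Lemma minimal_nonstandard_exists m : nonstandard m ->
  exists2 g, minimal_nonstandard g & (g <= m)%MM.
Proof.
have [c] := ubnP (mdeg m); elim: c m => // c IH m mc nm.
have [[m' [nm' m'm m'_neq]]|nom] := pselect (exists m', [/\ nonstandard m', (m' <= m)%MM & m' != m]).
  have [|g gmin gm'] := IH m' _ nm'; last by exists g => //; apply: lepm_trans gm' m'm.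
  rewrite -ltnS; apply: leq_trans mc; rewrite ltnS -(submK m'm) mdegD -[X in (X < _)%N]add0n ltn_add2r.
  rewrite lt0n mdeg_eq0; apply: contra m'_neq => /eqP mm'.
  by rewrite -(submK m'm) mm' add0m.
exists m; last exact: lepm_refl.
split=> // m' nm' m'm; apply/eqP; apply: contraT => m'_neq.
by case: nom; exists m'.
Qed.

(** A variable common to m and m' could be cancelled from both, leaving a smaller nonstandard
    monomial. *)
Lemma minimal_nonstandard_disjoint m m' l : minimal_nonstandard m ->
  wt m' = wt m -> rlt m' m -> (0 < m l)%N -> (0 < m' l)%N -> False.
Proof.
move=> [_ mmin] wE m'm ml m'l.
have lel (q : 'X_{1..n}) : (0 < q l)%N -> (U_(l) <= q)%MM by rewrite lep1mP lt0n.
have := mmin (m - U_(l))%MM; rewrite lem_subr => /(_ _ isT) E.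
have {E} /mnmP/(_ l) : (m - U_(l))%MM = m.
  apply: E; exists (m' - U_(l))%MM.
    apply: (@addIm _ (mu l)); rewrite -[mu l](weight1 mu) -!weightD !submK //; exact: lel.
  by apply/(revlex_lt_add _ U_(l)); rewrite !submK //; apply: lel.
by rewrite mnmBE mnm1E eqxx; move: ml; case: (m l) => // c _ /=; lia.
Qed.

(* With m' below m of the same degree, the smallest variable of m and m' is some
   y_j with j <> i; cancelling y_i in m and y_j in m' and using the condition
   yields a smaller monomial of the degree of m / y_i, against minimality. *)
Lemma minimal_nonstandard_y_free m i :
    (forall e (i j : 'I_r), i != j ->
       H (e + U_(i) *+ M)%MM -> H (e + U_(j) *+ M)%MM -> H e) ->
  minimal_nonstandard m -> m (y i) = 0%N.
Proof.
move=> cond mmin; have [[m' wE m'm] mmin2] := mmin; have m'm_lt := m'm.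
have [le_refl le_anti le_trans le_tot] := le_total.
have disj := minimal_nonstandard_disjoint mmin wE m'm_lt.
case: m'm => v [mv mlow].
apply/eqP; rewrite -leqn0 leqNgt; apply/negP => myi.
have m'yi : m' (y i) = 0%N.
  by apply/eqP; rewrite -leqn0 leqNgt; apply/negP; apply: disj.
have mv0 : m v = 0%N.
  apply/eqP; rewrite -leqn0 leqNgt; apply/negP => mv0; apply: (disj v) => //.
  exact: leq_trans mv.
have yiv : y i != v by apply: contraTneq myi => ->; rewrite mv0.
have lev : le_var v (y i).
  have [//|levi] := orP (le_tot v (y i)).
  by move: myi; rewrite mlow // m'yi.
have [j vj] := y_small lev; rewrite {v}vj in mv mlow mv0 yiv lev.
have ij : i != j by apply: contra yiv => /eqP->.
have low w : le_var w (y j) -> m w = 0%N.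
  move=> lew; have [->//|wj] := eqVneq w (y j).
  apply/eqP; rewrite -leqn0 leqNgt; apply/negP => mw; apply: (disj w) => //.
  by rewrite -mlow.
pose q := (m - U_(y i))%MM; pose q' := (m' - U_(y j))%MM.
have qE : wt m = (wt q + U_(i) *+ M)%MM.
  by rewrite -weight_yD submK // lep1mP -lt0n.
have q'E : wt m = (wt q' + U_(j) *+ M)%MM.
  by rewrite -wE -weight_yD submK // lep1mP -lt0n; apply: leq_trans mv.
(* Coordinate j of [wt m], computed through q and through q', shows that [wt q] is at least M
   there. *)
have qj : (U_(j) *+ M <= wt q)%MM.
  apply/mnm_lepP => l; rewrite mulmnE mnm1E; case: eqP => [<-|_] //.
  have : wt m j = wt m j by []; rewrite {1}qE q'E !mnmDE !mulmnE !mnm1E eqxx (negPf ij).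
  by rewrite mul0n mul1n addn0 => ->; rewrite leq_addl.
have [m'' m''E] : H (wt q - U_(j) *+ M)%MM.
  apply: (cond _ i j ij); last by rewrite submK //; exists q.
  exists q'; apply: (@addIm _ (U_(j) *+ M)%MM); rewrite -q'E qE.
  by rewrite -addmA [(U_(i) *+ M + _)%MM]addmC addmA submK.
suff nq : nonstandard q.
  have /mnmP/(_ (y i)) : q = m by apply: mmin2 => //; apply: lem_subr.
  by rewrite mnmBE mnm1E eqxx; move: myi; case: (m (y i)) => // c _ /=; lia.
(* This monomial contains [y j], whereas q has no variable up to [y j]; hence it is the smaller
   one. *)
exists (m'' + U_(y j))%MM; first by rewrite weight_yD -m''E submK.
have q_low w : le_var w (y j) -> q w = 0%N by move=> /low mw; rewrite mnmBE mw.
have [|//|[w [qw wlow]]] := @revlex_lt_total n le_var le_total (m'' + U_(y j))%MM q.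
  apply/eqP => /mnmP/(_ (y j)); rewrite q_low // mnmDE mnm1E eqxx addn1.
  by [].
have nwj : ~ le_var w (y j) by move=> /q_low qw0; rewrite qw0 in qw.
have [//|lejw] := orP (le_tot w (y j)).
have jw : y j != w by apply: contra_not_neq nwj => <-.
have := wlow _ jw lejw; rewrite mnmDE mnm1E eqxx q_low // addn1.
by [].
Qed.

End NonStandardMonomials.

(** * Coordinates with respect to the extremal rays *)

Lemma rat_nonneg_frac (q : rat) : 0 <= q ->
  exists c b : nat, (0 < b)%N /\ b%:R * q = c%:R.
Proof.
move=> q0; exists `|numq q|%N, `|denq q|%N.
rewrite absz_gt0 denq_neq0; split=> //.
have nq : 0 <= numq q by rewrite numq_ge0.
rewrite -[X in _ * X]divq_num_den !natr_absz (ger0_norm nq) (gtr0_norm (denq_gt0 q)).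
by rewrite mulrC divfK // intr_eq0 denq_neq0.
Qed.

Section Coordinates.
Variables (d r s : nat) (a : 'I_(r + s) -> 'rV[int]_d).
Hypotheses (hpos : forall x : 'rV[rat]_d,
    pos a [set: 'I_(r + s)] x <-> pos a [set lshift s i | i : 'I_r] x)
  (hr : r = rankZ a).

Let e (i : 'I_r) : 'rV[rat]_d := map_mx intr (a (lshift s i)).

Lemma nonneg_coordinates j : exists2 lam : 'I_r -> rat, forall i, 0 <= lam i &
  map_mx intr (a j) = \sum_i lam i *: e i.
Proof.
have [|lam lam0 aE] := (hpos (map_mx intr (a j))).1.
  exists (fun l => (l == j)%:R) => [i|]; first exact: ler0n.
  rewrite (bigD1 j) ?inE //= eqxx scale1r big1 ?addr0 // => i /andP[_ /negPf->].
  by rewrite scale0r.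
exists (fun i => lam (lshift s i)) => //.
by rewrite aE big_imset //= => i i' _ _; apply: lshift_inj.
Qed.

(** The r vectors [e i] span the space of all generators, whose dimension is r. *)
Lemma extremal_free (c c' : 'I_r -> rat) :
  \sum_i c i *: e i = \sum_i c' i *: e i -> c =1 c'.
Proof.
pose E : 'M[rat]_(r, d) := \matrix_i e i.
have sumE (u : 'I_r -> rat) : \sum_i u i *: e i = (\row_i u i) *m E.
  by rewrite mulmx_sum_row; apply: eq_bigr => i _; rewrite mxE rowK.
have freeE : row_free E.
  rewrite /row_free eqn_leq rank_leq_row {1}hr /rankZ mxrankS //.
  apply/row_subP => j; rewrite rowK; have [lam _ ->] := nonneg_coordinates j.
  by rewrite sumE submxMl.
rewrite !sumE => /(row_free_inj freeE)/rowP cE i.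
by have := cE i; rewrite !mxE.
Qed.

Lemma integral_coordinates : exists (M : nat) (mu : 'I_(r + s) -> 'X_{1..r}),
  [/\ (0 < M)%N, forall i, mu (lshift s i) = (U_(i) *+ M)%MM &
      forall m m', degA a m = degA a m' <-> weight mu m = weight mu m'].
Proof.
have /all_sig2[lam lam0 lamE] : forall j, {lam : 'I_r -> rat | forall i, 0 <= lam i &
    map_mx intr (a j) = \sum_i lam i *: e i}.
  by move=> j; apply/cid2/nonneg_coordinates.
have /all_sig[cb Hcb] : forall ji : 'I_(r + s) * 'I_r, {cb : nat * nat |
    (0 < cb.2)%N /\ cb.2%:R * lam ji.1 ji.2 = cb.1%:R}.
  move=> [j i]; apply: cid; have [c [b Hb]] := rat_nonneg_frac (lam0 j i).
  by exists (c, b).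
(* A common denominator of all coordinates. *)
pose M := (\prod_ji (cb ji).2)%N.
have M0 : (0 < M)%N by rewrite prodn_gt0 // => ji; have [] := Hcb ji.
have /all_sig[c Hc] : forall ji : 'I_(r + s) * 'I_r, {c : nat | M%:R * lam ji.1 ji.2 = c%:R}.
  move=> ji; exists ((\prod_(l | l != ji) (cb l).2) * (cb ji).1)%N.
  rewrite /M (bigD1 ji) //= mulnC !natrM -mulrA; congr (_ * _).
  by have [] := Hcb ji.
pose mu j : 'X_{1..r} := if split j is inl i then (U_(i) *+ M)%MM
                         else [multinom c (j, i) | i < r].
have mu_l i : mu (lshift s i) = (U_(i) *+ M)%MM.
  rewrite /mu; case: splitP => [i' /= E|l /= E]; last by have := ltn_ord i; lia.
  by rewrite (_ : i = i') //; apply: val_inj.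
have muE j : M%:R *: map_mx intr (a j) = \sum_i (mu j i)%:R *: e i :> 'rV[rat]_d.
  rewrite /mu; case: splitP => [i E|l E].
    rewrite (_ : j = lshift s i); last exact: val_inj.
    rewrite (bigD1 i) //= mulmnE mnm1E eqxx mul1n big1 ?addr0 // => i' i'i.
    by rewrite mulmnE mnm1E eq_sym (negPf i'i) mul0n scale0r.
  rewrite lamE scaler_sumr; apply: eq_bigr => i _.
  by rewrite mnmE scalerA (Hc (j, i)).
exists M, mu; split=> // m m'.
(* M times the degree has the weight as its coordinates, so the two determine each other by freeness
   and M being nonzero. *)
have wE (q : 'X_{1..r + s}) : M%:R *: map_mx intr (degA a q) =
    \sum_i (weight mu q i)%:R *: e i :> 'rV[rat]_d.
  rewrite /degA raddf_sum scaler_sumr.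
  under eq_bigr do rewrite raddfMn /= -scaler_nat scalerA mulrC -scalerA muE scaler_sumr.
  rewrite exchange_big; apply: eq_bigr => i _ /=.
  rewrite weightE natr_sum scaler_suml; apply: eq_bigr => j _.
  by rewrite scalerA natrM mulrC.
split=> [degE|wtE].
  apply/mnmP => i; have := wE m; rewrite degE wE => /extremal_free/(_ i).
  by move=> /eqP; rewrite eqr_nat => /eqP.
have : M%:R *: map_mx intr (degA a m) = M%:R *: map_mx intr (degA a m') :> 'rV[rat]_d.
  by rewrite !wE wtE.
move=> /scalerI H; have {H} : map_mx intr (degA a m) = map_mx intr (degA a m') :> 'rV[rat]_d.
  by apply: H; rewrite pnatr_eq0 -lt0n.
by move=> /rowP H; apply/rowP => l; have := H l; rewrite !mxE => /eqP; rewrite eqr_int => /eqP.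
Qed.

End Coordinates.

(** * The embedding of k[S] into a polynomial ring, and the toric ideal *)

Section SemigroupAlgebraEmbedding.
Variables (k : fieldType) (d n r : nat) (a : 'I_n -> 'rV[int]_d) (ha : pointed a).
Variable mu : 'I_n -> 'X_{1..r}.
Hypothesis degA_weight : forall m m', degA a m = degA a m' <-> weight mu m = weight mu m'.
Local Notation S := (affine_semigroup ha).
Local Notation wt := (weight mu).

Lemma degS_surj (z : S) : exists m, z = degS ha m.
Proof. by have /asboolP[m zE] := sgvalP z; exists m; apply: val_inj. Qed.

(** By [degA_weight] the choice of the monomial of degree z does not matter. *)
Definition exponent (z : S) : 'X_{1..r} := wt (sval (cid (degS_surj z))).

Lemma exponent_degS m : exponent (degS ha m) = wt m.
Proof.
rewrite /exponent; case: cid => m' /= /(congr1 val) /= degE.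
by apply/esym/degA_weight.
Qed.

Lemma degSD m m' : degS ha (m + m')%MM = mul (degS ha m) (degS ha m').
Proof. by apply: val_inj; rewrite /= degAD. Qed.

Lemma exponent_inj : injective exponent.
Proof.
move=> z z'; have [m ->] := degS_surj z; have [m' ->] := degS_surj z'.
by rewrite !exponent_degS => /degA_weight degE; apply: val_inj.
Qed.

Definition exponent_monomial (z : S) : {mpoly k[r]} := 'X_[exponent z].

Lemma exponent_monomial_mmorphism : mmorphism exponent_monomial.
Proof.
split=> [z z'|]; rewrite /exponent_monomial.
  have [m ->] := degS_surj z; have [m' ->] := degS_surj z'.
  by rewrite -degSD !exponent_degS weightD mpolyXD.
by rewrite (exponent_degS 0%MM) weight0 mpolyX0.
Qed.

HB.instance Definition _ :=
  monalg.isMultiplicative.Build S {mpoly k[r]} exponent_monomial exponent_monomial_mmorphism.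

Definition embedding : {rmorphism semigroup_algebra ha k -> {mpoly k[r]}} :=
  monalg.mmap (@mpolyC r k) exponent_monomial.

Definition constant : {rmorphism k -> semigroup_algebra ha k} := @mkmalgU S k (sg_one ha).

Definition char_monomial (j : 'I_n) : semigroup_algebra ha k := mkmalgU (degS ha U_(j)%MM) 1.

Lemma embedding_constant c : embedding (constant c) = c%:MP.
Proof. exact: (monalg.mmapC (h := exponent_monomial)). Qed.

Lemma embedding_monomial m c :
  embedding (mkmalgU (degS ha m) c) = c *: 'X_[wt m].
Proof. by rewrite /embedding /= monalg.mmapU /exponent_monomial exponent_degS mul_mpolyC. Qed.

Lemma embedding_char j : embedding (char_monomial j) = 'X_[mu j].
Proof. by rewrite embedding_monomial scale1r weight1. Qed.

Lemma embeddingE (g : semigroup_algebra ha k) :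
  embedding g = \sum_(z <- monalg.msupp g) monalg.mcoeff z g *: 'X_[exponent z].
Proof. by apply: eq_bigr => z _; rewrite mul_mpolyC. Qed.

Lemma embedding_coeff (g : semigroup_algebra ha k) z :
  (embedding g)@_(exponent z) = monalg.mcoeff z g.
Proof.
rewrite [in RHS](monalgE g) embeddingE !raddf_sum /=; apply: eq_bigr => w _.
rewrite mcoeffZ mcoeffX (inj_eq exponent_inj) mcoeffU.
by case: eqP => _; rewrite ?mulr1 ?mulr0 ?mulr1n ?mulr0n.
Qed.

Lemma embedding_injective : injective embedding.
Proof.
by move=> g g' gE; apply/malgP => z; rewrite -!embedding_coeff gE.
Qed.

Lemma embedding_supp (g : semigroup_algebra ha k) s :
  s \in msupp (embedding g) -> weight_monoid mu s.
Proof.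
rewrite embeddingE => /msupp_sum_le/flattenP[_ /mapP[z _ ->]] /msuppZ_le.
rewrite msuppX inE => /eqP->; have [m ->] := degS_surj z.
by exists m; rewrite exponent_degS.
Qed.

Lemma toric_idealE (f : {mpoly k[n]}) :
  toric_ideal ha f <-> \sum_(m <- msupp f) f@_m *: 'X_[wt m] = 0 :> {mpoly k[r]}.
Proof.
have -> : \sum_(m <- msupp f) f@_m *: 'X_[wt m] = embedding (toric_map ha f) :> {mpoly k[r]}.
  rewrite /toric_map (raddf_sum embedding); apply: eq_bigr => m _.
  rewrite [RHS](monalg.mmapZ (h := exponent_monomial)) mul_mpolyC; congr (_ *: _).
  by rewrite monalg.mmapU /= mpolyC1 mul1r /exponent_monomial exponent_degS.
split=> [->|H]; first by rewrite rmorph0.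
by apply: embedding_injective; rewrite H rmorph0.
Qed.

Variable le_var : rel 'I_n.

Lemma Agrevlex_lt_weight m' m : wt m' = wt m ->
  Agrevlex_lt a le_var m' m <-> revlex_lt le_var m' m.
Proof.
move=> /degA_weight degE; split=> [[[i]|[]]//|]; last by right.
by rewrite degE subrr mxE ltxx.
Qed.

(** The leading term of an element of the toric ideal must cancel against another monomial of the
    same weight, which is smaller; conversely X^m - X^m' is in the ideal for m' of the weight of
    m. *)
Lemma initial_monomialE m :
  (exists f : {mpoly k[n]}, [/\ toric_ideal ha f, f != 0 &
     leading_monomial (Agrevlex_lt a le_var) f m]) <-> nonstandard le_var mu m.
Proof.
split=> [[f [/toric_idealE f0 _ [mf mlead]]]|[m' wE m'm]].
  have [m' [m'f m'_neq wE]] : exists m', [/\ m' \in msupp f, m' != m & wt m' = wt m].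
    apply: contrapT => nom; move: (mf); rewrite mcoeff_msupp => /negP; apply; apply/eqP.
    have := congr1 (mcoeff (wt m)) f0; rewrite mcoeff0 raddf_sum (bigD1_seq m) ?msupp_uniq //=.
    rewrite mcoeffZ mcoeffX eqxx mulr1 big_seq_cond big1 ?addr0 // => m' /andP[m'f m'm].
    rewrite mcoeffZ mcoeffX; case: eqP => [wE|_]; last by rewrite mulr0.
    by case: nom; exists m'.
  by exists m' => //; apply/Agrevlex_lt_weight => //; apply: mlead.
have mm' : m' != m by apply: contraPneq m'm => ->; apply: revlex_lt_irr.
pose f : {mpoly k[n]} := 'X_[m] - 'X_[m'].
have fm : f@_m = 1 by rewrite mcoeffB !mcoeffX eqxx (negPf mm') subr0.
have mf : m \in msupp f by rewrite mcoeff_msupp fm oner_neq0.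
have fsupp q : q \in msupp f -> q != m -> q = m'.
  by move=> /msuppB_le; rewrite mem_cat !msuppX !inE => /orP[/eqP->|/eqP->//]; rewrite eqxx.
exists f; split.
- apply/toric_idealE; rewrite (bigD1_seq m) ?msupp_uniq //= fm scale1r.
  have m'f : m' \in msupp f.
    by rewrite mcoeff_msupp mcoeffB !mcoeffX eqxx [m == m']eq_sym (negPf mm') sub0r oppr_eq0 oner_neq0.
  rewrite -big_filter (bigD1_seq m') ?filter_uniq ?msupp_uniq ?mem_filter ?mm' //=.
  rewrite big_seq_cond big1 => [|q]; last first.
    by rewrite mem_filter => /andP[/andP[qm /fsupp qE] qm']; rewrite qE ?eqxx in qm'.
  rewrite mcoeffB !mcoeffX eqxx [m == m']eq_sym (negPf mm') sub0r scaleNr scale1r wE addr0.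
  exact: subrr.
- by apply: contraTneq mf => ->; rewrite msupp0.
- split=> // q /fsupp H /H ->; exact/Agrevlex_lt_weight.
Qed.

End SemigroupAlgebraEmbedding.

(** * The Cohen-Macaulay property read off from the initial ideal *)

Theorem corollary12 (k : fieldType) (d r s : nat)
    (a : 'I_(r + s) -> 'rV[int]_d) (a_inj : injective a) (ha : pointed a)
    (hpos : forall x : 'rV[rat]_d,
       pos a [set: 'I_(r + s)] x <-> pos a [set lshift s i | i : 'I_r] x)
    (hsimplicial : simplicial a) (hr : r = rankZ a)
    (le_var : rel 'I_(r + s)) (hle : total_order le_var)
    (hYZ : forall (i : 'I_r) (j : 'I_s), le_var (lshift s i) (rshift r j)) :
  cohen_macaulay (semigroup_algebra ha k) <->
  exists2 G : 'X_{1..r + s} -> Prop,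
    minimal_monomial_generators
      (initial_ideal (Agrevlex_lt a le_var) (toric_ideal ha (k := k))) G &
    forall m, G m -> forall i : 'I_r, m (lshift s i) = 0%N.
Proof.
have [M [mu [M_gt0 mu_y degA_weight]]] := integral_coordinates hpos hr.
have mu_neq0 j : mu j != 0%MM.
  apply/eqP => muj; have /degA_weight : weight mu U_(j)%MM = weight mu 0%MM.
    by rewrite weight1 weight0.
  by rewrite degA0 => /ha/(_ j); rewrite mnm1E eqxx.
have y_small v i : le_var v (lshift s i) -> exists j, v = lshift s j.
  have [_ le_anti _ _] := hle; rewrite -[v]splitK; case: (split v) => j /= lev; first by exists j.
  have /le_anti/eqP : le_var (rshift r j) (lshift s i) && le_var (lshift s i) (rshift r j).
    by rewrite lev hYZ.
  by rewrite eq_rlshift.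
have iota_inj := @embedding_injective k _ _ _ _ ha _ degA_weight.
have iota_cst := @embedding_constant k _ _ _ _ ha _ degA_weight.
have iota_x := @embedding_char k _ _ _ _ ha _ degA_weight.
have iota_supp := @embedding_supp k _ _ _ _ ha _ degA_weight.
have initE (f : {mpoly k[r + s]}) :
    initial_ideal (Agrevlex_lt a le_var) (toric_ideal ha (k := k)) f <->
    forall m, m \in msupp f -> exists2 g, nonstandard le_var mu g & (g <= m)%MM.
  rewrite /initial_ideal monomial_idealP.
  split=> H m /H[g ng gm]; exists g => //; exact/(initial_monomialE k ha degA_weight).
split=> [CM|[G [Ggen _] Gy]].
  have cond := cohen_macaulay_condition iota_inj iota_cst M_gt0 mu_y iota_x iota_supp CM.
  exists (minimal_nonstandard le_var mu) => [|m mmin i]; last first.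
    exact: (minimal_nonstandard_y_free hle M_gt0 mu_y y_small i cond mmin).
  split=> [f|G' G'min G'gen m [nm mmin]].
    rewrite initE monomial_idealP; split=> H m /H[g].
      by move=> /minimal_nonstandard_exists[g' g'min g'g] gm; exists g' => //; apply: lepm_trans gm.
    by case=> ng _ gm; exists g.
  have /G'gen/monomial_idealP : initial_ideal (Agrevlex_lt a le_var) (toric_ideal ha (k := k)) 'X_[m].
    by apply/initE => m'; rewrite msuppX inE => /eqP->; exists m; rewrite ?lepm_refl.
  rewrite msuppX => /(_ m (mem_head _ _))[g G'g gm].
  by have [ng _] := G'min g G'g; rewrite -(mmin g).
(* A generator dividing X^m Y_i is free of Y_i, so it divides X^m. *)
have nonstd_cancel m i : nonstandard le_var mu (m + U_(lshift s i))%MM -> nonstandard le_var mu m.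
  move=> nm; have /Ggen/monomial_idealP : initial_ideal (Agrevlex_lt a le_var)
      (toric_ideal ha (k := k)) 'X_[m + U_(lshift s i)].
    by apply/initE => m'; rewrite msuppX inE => /eqP->; exists (m + U_(lshift s i))%MM; rewrite ?lepm_refl.
  rewrite msuppX => /(_ _ (mem_head _ _))[g Gg /mnm_lepP gm].
  have : monomial_ideal G ('X_[g] : {mpoly k[r + s]}).
    by apply/monomial_idealP => m'; rewrite msuppX inE => /eqP->; exists g; rewrite ?lepm_refl.
  move=> /Ggen/initE; rewrite msuppX => /(_ _ (mem_head _ _))[g' ng' g'g].
  apply: nonstandardW ng' _; apply: lepm_trans g'g _; apply/mnm_lepP => j.
  have := gm j; rewrite mnmDE mnm1E; case: eqP => [<-|_]; last by rewrite addn0.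
  by rewrite (Gy g Gg).
(* [sigma] picks the standard monomial of each weight, with a dummy value off the monoid. *)
have /all_sig[sigma Hsigma] : forall t : 'X_{1..r}, {m | weight_monoid mu t ->
    weight mu m = t /\ ~ nonstandard le_var mu m}.
  move=> t; apply: cid; have [Ht|nHt] := pselect (weight_monoid mu t); last by exists 0%MM.
  by have [m mt nm] := standard_exists hle mu_neq0 Ht; exists m.
apply: (standard_cohen_macaulay iota_inj iota_cst (y := @lshift r s) _ mu_y iota_x iota_supp
  (sigma := sigma)).
- exact: lshift_inj.
- by move=> t /Hsigma[].
move=> t i Ht; have [wt nt] := Hsigma t Ht.
have [wtM ntM] : weight mu (sigma (t + U_(i) *+ M)%MM) = (t + U_(i) *+ M)%MM /\
    ~ nonstandard le_var mu (sigma (t + U_(i) *+ M)%MM).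
  apply: Hsigma; exists (sigma t + U_(lshift s i))%MM.
  by rewrite (weight_yD mu_y) wt.
(* By cancellation [sigma t] times Y_i is still standard, so it is the standard monomial of its
   weight. *)
apply: (standard_unique (mu := mu) hle) => //; last by move/nonstd_cancel.
by rewrite wtM (weight_yD mu_y) wt.
Qed.
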